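(* Let $R$ be an integral domain with fraction field $K$, and let $A$ be an $R$-algebra that is free of finite rank as an $R$-module, such that $A^K=K\otimes_R A$ is split and such that every non-zero prime ideal of $R$ admits a perfect $A$-gate. Let $\mathfrak{p}\in\operatorname{Spec}(R)$ be non-zero and let $\mathscr{O}$ be a perfect $A$-gate in $\mathfrak{p}$, with decomposition map $\mathrm{d}_A^{\mathfrak{p},\mathscr{O}}:\mathrm{G}_0(A^K)\to\mathrm{G}_0(A(\mathfrak{p}))$. Then there exists a (unique) adjoint $\mathrm{e}_A^{\mathfrak{p},\mathscr{O}}:\mathrm{K}_0(A(\mathfrak{p}))\to\mathrm{K}_0(A^K)$ of $\mathrm{d}_A^{\mathfrak{p},\mathscr{O}}$ with respect to the intertwining forms, i.e. a group morphism satisfying $$\langle\mathrm{e}_A^{\mathfrak{p},\mathscr{O}}([\overline{P}]),[V]\rangle_{A^K}=\langle[\overline{P}],\mathrm{d}_A^{\mathfrak{p},\mathscr{O}}([V])\rangle_{A(\mathfrak{p})}$$ for all finitely generated $A^K$-modules $V$ and all finitely generated projective $A(\mathfrak{p})$-modules $\overline{P}$. Moreover, $$\mathrm{c}_{A(\mathfrak{p})}=\mathrm{d}_A^{\mathfrak{p},\mathscr{O}}\circ\mathrm{c}_{A^K}\circ\mathrm{e}_A^{\mathfrak{p},\mathscr{O}},$$ where $\mathrm{c}_{A^K}$ and $\mathrm{c}_{A(\mathfrak{p})}$ are the Cartan maps. If $R$ is normal, then $\mathrm{e}_A^{\mathfrak{p},\mathscr{O}}$ does not depend on the choice of $\ma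thscr{O}$.
   Context: For a finite-dimensional algebra $B$ over a field $F$: $\mathrm{G}_0(B)$ is the Grothendieck group of finitely generated $B$-modules, $\mathrm{K}_0(B)$ is the Grothendieck group of finitely generated projective $B$-modules, the Cartan map $\mathrm{c}_B:\mathrm{K}_0(B)\to\mathrm{G}_0(B)$ sends $[P]$ to $[P]$, and the intertwining form is the $\mathbb{Z}$-bilinear pairing $\langle\cdot,\cdot\rangle_B:\mathrm{K}_0(B)\times\mathrm{G}_0(B)\to\mathbb{Z}$ with $\langle[P],[V]\rangle_B=\dim_F\operatorname{Hom}_B(P,V)$ (it is non-degenerate). $B$ is split if its simple modules remain simple under every extension of $F$. For $\mathfrak{p}\in\operatorname{Spec}(R)$, $A(\mathfrak{p})=\mathrm{k}(\mathfrak{p})\otimes_R A$ with $\mathrm{k}(\mathfrak{p})=\operatorname{Frac}(R/\mathfrak{p})$. For a non-zero $\mathfrak{p}$, a perfect $A$-gate in $\mathfrak{p}$ is a discrete valuation ring $\mathscr{O}$ with fraction field $K$ and maximal ideal $\mathfrak{m}$ which dominates $R_{\mathfrak{p}}$ (i.e. $R_{\mathfrak{p}}\subseteq\mathscr{O}$ and $\mathfrak{m}\cap R_{\mathfrak{p}}$ is the maximal ideal of $R_{\mathfrak p}$) and such that the scalar extension map $\mathrm{d}_A^{\mathfrak{p},\mathfrak{m}}:\mathrm{G}_0(A(\mathfrak{p}))\to\mathrm{G}_0(A^{\mathscr{O}}(\mathfrak{m}))$ along $\mathrm{k}(\mathfrak{p})\subseteq\mathrm{k}(\mathfrak{m})=\mathscr{O}/\mathfrak{m}$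 is an isomorphism; here $A^{\mathscr{O}}=\mathscr{O}\otimes_R A$ and $A^{\mathscr{O}}(\mathfrak{m})=A^{\mathscr{O}}/\mathfrak{m}A^{\mathscr{O}}$. The decomposition map $\mathrm{d}_A^{\mathfrak{p},\mathscr{O}}$ is the group morphism given by $[V]\mapsto(\mathrm{d}_A^{\mathfrak{p},\mathfrak{m}})^{-1}([\widetilde{V}/\mathfrak{m}\widetilde{V}])$, where $\widetilde{V}$ is any $A^{\mathscr{O}}$-lattice in $V$ (an $A^{\mathscr{O}}$-submodule of $V$ that is $\mathscr{O}$-free of finite rank and spans $V$ over $K$); this is well defined. If $R$ is normal, it is a known result (Geck–Rouquier) that $\mathrm{d}_A^{\mathfrak{p},\mathscr{O}}$ is independent of the choice of $\mathscr{O}$. *)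

(* Defs.v *)
From HB Require Import structures.
From mathcomp Require Import all_boot all_order all_algebra.
From mathcomp Require Import boolp.
From mathcomp Require Import freeg.
Set Implicit Arguments.
Unset Strict Implicit.
Unset Printing Implicit Defensive.
Import Order.TTheory GRing.Theory Num.Theory.
Local Open Scope ring_scope.

(* An associative unital R-algebra, i.e. a ring with a ring morphism from R to
   its centre, which is free of finite rank as an R-module: [acoord] gives the
   coordinates in some basis.  MathComp's algType is not used because it
   excludes the zero algebra. *)
Record freeAlg (R : comNzRingType) := FreeAlg {
  aring :> pzRingType;
  ascal : {rmorphism R -> aring};
  ascalC : forall (r : R) (a : aring), ascal r * a = a * ascal r;
  arank : nat;
  acoord : aring -> 'rV[R]_arank;
  acoord_bij : bijective acoord;
  acoord_lin : forall (r : R) (a b : aring),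
    acoord (ascal r * a + b) = r *: acoord a + acoord b
}.
Arguments arank {R} A : rename.
Arguments ascal {R} A : rename.
Arguments acoord {R A} a : rename.

Section FreeAlgTheory.
Variables (R : comNzRingType) (A : freeAlg R).
Implicit Types (a b : A) (r : R).

Lemma acoordD a b : acoord (a + b) = acoord a + acoord b.
Proof. by rewrite -[a in LHS]mul1r -(rmorph1 (ascal A)) acoord_lin scale1r. Qed.

Lemma acoord0 : acoord (0 : A) = 0.
Proof. by apply: (@addIr _ (acoord (0 : A))); rewrite -acoordD !add0r. Qed.

Lemma acoordZ r a : acoord (ascal A r * a) = r *: acoord a.
Proof. by rewrite -[X in acoord X]addr0 acoord_lin acoord0 addr0. Qed.

Lemma acoord_sum I (s : seq I) (P : pred I) (f : I -> A) :
  acoord (\sum_(i <- s | P i) f i) = \sum_(i <- s | P i) acoord (f i).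
Proof. exact: (big_morph _ acoordD acoord0). Qed.

Lemma abasis_key (i : 'I_(arank A)) : {a : A | acoord a = delta_mx 0 i}.
Proof.
by apply: cid; have [g _ gK] := acoord_bij A; exists (g (delta_mx 0 i)).
Qed.

Definition abasis i : A := sval (abasis_key i).

Lemma acoord_basis i : acoord (abasis i) = delta_mx 0 i.
Proof. exact: svalP (abasis_key i). Qed.

Lemma abasis_sum a : a = \sum_i ascal A (acoord a 0 i) * abasis i.
Proof.
apply: (bij_inj (acoord_bij A)); rewrite acoord_sum [LHS]row_sum_delta.
by apply: eq_bigr => i _; rewrite acoordZ acoord_basis.
Qed.

End FreeAlgTheory.

(* The scalar extension S (x)_R A along phi : R -> S.  As A is free over R, this
   is the free S-module on the basis of A, with the structure constants of A
   transported along phi; [bcin] is a |-> 1 (x) a. *)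
Definition bchange_sort (R S : comNzRingType) (phi : {rmorphism R -> S})
  (A : freeAlg R) : Type := 'rV[S]_(arank A).

Section BaseChange.
Variables (R S : comNzRingType) (phi : {rmorphism R -> S}) (A : freeAlg R).
Local Notation bchange_sort := (bchange_sort phi A).

HB.instance Definition _ := GRing.Zmodule.on bchange_sort.

Implicit Types (x y z : bchange_sort) (a b : A) (s : S).

Definition bcscale s x : bchange_sort := s *: (x : 'rV[S]_(arank A)).

Definition bcin a : bchange_sort := map_mx phi (acoord a).

Definition bcmul x y : bchange_sort :=
  \sum_i \sum_j bcscale (x 0 i * y 0 j) (bcin (abasis i * abasis j)).

Lemma bcinD a b : bcin (a + b) = bcin a + bcin b.
Proof. by rewrite /bcin acoordD map_mxD. Qed.

Lemma bcin0 : bcin 0 = 0.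
Proof. by rewrite /bcin acoord0 map_mx0. Qed.

Lemma bcinZ r a : bcin (ascal A r * a) = bcscale (phi r) (bcin a).
Proof. by rewrite /bcin acoordZ map_mxZ. Qed.

Lemma bcin_sum I (s : seq I) (P : pred I) (f : I -> A) :
  bcin (\sum_(i <- s | P i) f i) = \sum_(i <- s | P i) bcin (f i).
Proof. exact: (big_morph _ bcinD bcin0). Qed.

Lemma bcin_basis i : bcin (abasis i) = delta_mx 0 i.
Proof. by rewrite /bcin acoord_basis map_delta_mx. Qed.

Lemma bcE x : x = \sum_i bcscale (x 0 i) (bcin (abasis i)).
Proof.
by rewrite [LHS]row_sum_delta; apply: eq_bigr => i _; rewrite bcin_basis.
Qed.

Lemma bcscale1 x : bcscale 1 x = x. Proof. exact: scale1r. Qed.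
Lemma bcscaleA s t x : bcscale s (bcscale t x) = bcscale (s * t) x.
Proof. exact: scalerA. Qed.
Lemma bcscaleDl s t x : bcscale (s + t) x = bcscale s x + bcscale t x.
Proof. exact: scalerDl. Qed.
Lemma bcscaleDr s x y : bcscale s (x + y) = bcscale s x + bcscale s y.
Proof. exact: scalerDr. Qed.
Lemma bcscale0 s : bcscale s 0 = 0. Proof. exact: scaler0. Qed.
Lemma bcscale_sum s I (r : seq I) (P : pred I) (f : I -> bchange_sort) :
  bcscale s (\sum_(i <- r | P i) f i) = \sum_(i <- r | P i) bcscale s (f i).
Proof. exact: (big_morph _ (bcscaleDr s) (bcscale0 s)). Qed.

Lemma bcmulDl : left_distributive bcmul +%R.
Proof.
move=> x y z; rewrite /bcmul -big_split; apply: eq_bigr => i _ /=.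
rewrite -big_split; apply: eq_bigr => j _ /=.
by rewrite -bcscaleDl -mulrDl mxE.
Qed.

Lemma bcmulDr : right_distributive bcmul +%R.
Proof.
move=> x y z; rewrite /bcmul -big_split; apply: eq_bigr => i _ /=.
rewrite -big_split; apply: eq_bigr => j _ /=.
by rewrite -bcscaleDl -mulrDr mxE.
Qed.

Lemma bcmulZl s x y : bcmul (bcscale s x) y = bcscale s (bcmul x y).
Proof.
rewrite /bcmul bcscale_sum; apply: eq_bigr => i _.
rewrite bcscale_sum; apply: eq_bigr => j _.
by rewrite bcscaleA mulrA mxE.
Qed.

Lemma bcmulZr s x y : bcmul x (bcscale s y) = bcscale s (bcmul x y).
Proof.
rewrite /bcmul bcscale_sum; apply: eq_bigr => i _.
rewrite bcscale_sum; apply: eq_bigr => j _.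
by rewrite bcscaleA mulrCA mxE.
Qed.

Lemma bcmul0 x : bcmul x 0 = 0.
Proof. by apply: (addIr (bcmul x 0)); rewrite -bcmulDr !add0r. Qed.
Lemma bc0mul x : bcmul 0 x = 0.
Proof. by apply: (addIr (bcmul 0 x)); rewrite -bcmulDl !add0r. Qed.

Lemma bcmul_in a b : bcmul (bcin a) (bcin b) = bcin (a * b).
Proof.
rewrite {2}(abasis_sum a) mulr_suml bcin_sum /bcmul; apply: eq_bigr => i _.
rewrite {2}(abasis_sum b) mulr_sumr bcin_sum; apply: eq_bigr => j _.
by rewrite -mulrA (mulrA (abasis i)) -ascalC -mulrA !bcinZ bcscaleA !mxE.
Qed.

Lemma bc_ind (P : bchange_sort -> Prop) :
    P 0 -> (forall x y, P x -> P y -> P (x + y)) ->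
    (forall s a, P (bcscale s (bcin a))) -> forall x, P x.
Proof. by move=> P0 PD PZ x; rewrite (bcE x); apply: big_ind. Qed.

Lemma bcmulA : associative bcmul.
Proof.
move=> x y z; elim/bc_ind: x => [|u v IHu IHv|r a]; first by rewrite !bc0mul.
  by rewrite !bcmulDl IHu IHv.
rewrite !bcmulZl; congr bcscale.
elim/bc_ind: y => [|u v IHu IHv|s b]; first by rewrite bcmul0 !bc0mul bcmul0.
  by rewrite bcmulDl !bcmulDr bcmulDl IHu IHv.
rewrite bcmulZr !bcmulZl bcmulZr; congr bcscale.
elim/bc_ind: z => [|u v IHu IHv|t c]; first by rewrite !bcmul0.
  by rewrite !bcmulDr IHu IHv.
by rewrite !bcmulZr !bcmul_in mulrA.
Qed.

Lemma bcmul1l : left_id (bcin 1) bcmul.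
Proof.
move=> x; elim/bc_ind: x => [|u v IHu IHv|s a]; first exact: bcmul0.
  by rewrite bcmulDr IHu IHv.
by rewrite bcmulZr bcmul_in mul1r.
Qed.

Lemma bcmul1r : right_id (bcin 1) bcmul.
Proof.
move=> x; elim/bc_ind: x => [|u v IHu IHv|s a]; first exact: bc0mul.
  by rewrite bcmulDl IHu IHv.
by rewrite bcmulZl bcmul_in mulr1.
Qed.

HB.instance Definition _ := GRing.Zmodule_isPzRing.Build bchange_sort
  bcmulA bcmul1l bcmul1r bcmulDl bcmulDr.

Definition bcscal s : bchange_sort := bcscale s 1.

Lemma bcscal_is_zmod : zmod_morphism bcscal.
Proof. by move=> s t; rewrite /bcscal /bcscale scalerBl. Qed.

Lemma bcscal_is_monoid : monoid_morphism bcscal.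
Proof.
split=> [|s t]; first exact: bcscale1.
by rewrite /bcscal [RHS]bcmulZl bcmul1l bcscaleA.
Qed.

HB.instance Definition _ := GRing.isZmodMorphism.Build S bchange_sort bcscal
  bcscal_is_zmod.
HB.instance Definition _ := GRing.isMonoidMorphism.Build S bchange_sort bcscal
  bcscal_is_monoid.

Lemma bcscalE s x : bcscal s * x = bcscale s x.
Proof. by rewrite [LHS]bcmulZl bcmul1l. Qed.

Lemma bcscalC s x : bcscal s * x = x * bcscal s.
Proof. by rewrite bcscalE [RHS]bcmulZr bcmul1r. Qed.

Lemma bcscal_lin s x y :
  (bcscal s * x + y : 'rV[S]_(arank A)) = s *: (x : 'rV_(arank A)) + y.
Proof. by rewrite bcscalE. Qed.

Definition bchange : freeAlg S :=
  @FreeAlg S bchange_sort bcscal bcscalC (arank A) id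
    (Bijective (fun=> erefl) (fun=> erefl)) bcscal_lin.

End BaseChange.

(* Finitely generated modules, up to a choice of S-basis: a left B-module
   structure on the space of column vectors S^mdim, given by the matrices of the
   action.  Over a field these are all finitely generated B-modules, and over
   any S all B-modules that are free of finite rank over S. *)
Record module (S : comNzRingType) (B : freeAlg S) := Module {
  mdim : nat;
  mact : B -> 'M[S]_mdim;
  mact_lin : forall (s : S) (a b : B),
    mact (ascal B s * a + b) = s *: mact a + mact b;
  mact1 : mact 1 = 1%:M;
  mactM : forall a b : B, mact (a * b) = mact a *m mact b
}.

Definition mod_hom (S : comNzRingType) (B : freeAlg S) (V W : module B)
    (X : 'M[S]_(mdim W, mdim V)) : Prop :=
  forall b : B, mact W b *m X = X *m mact V b.

(* 0 -> V' -> V -> V'' -> 0 is exact for some morphisms V' -> V -> V''. *)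
Definition short_exact (S : comNzRingType) (B : freeAlg S)
    (V V' V'' : module B) : Prop :=
  exists (X : 'M[S]_(mdim V, mdim V')) (Y : 'M[S]_(mdim V'', mdim V)),
    [/\ mod_hom X, mod_hom Y,
        forall u : 'cV_(mdim V'), X *m u = 0 -> u = 0,
        forall w : 'cV_(mdim V''), exists v : 'cV_(mdim V), w = Y *m v &
        forall v : 'cV_(mdim V), Y *m v = 0 <-> exists u : 'cV_(mdim V'), v = X *m u].

(* Projectivity in the category of finitely generated modules; for a finitely
   generated P this is projectivity among all modules. *)
Definition mod_projective (S : comNzRingType) (B : freeAlg S)
    (P : module B) : Prop :=
  forall (M N : module B) (f : 'M[S]_(mdim N, mdim M))
         (g : 'M[S]_(mdim N, mdim P)),
    mod_hom f -> mod_hom g ->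
    (forall w : 'cV_(mdim N), exists v : 'cV_(mdim M), w = f *m v) ->
    exists2 h : 'M[S]_(mdim M, mdim P), mod_hom h & f *m h = g.

Record projmod (S : comNzRingType) (B : freeAlg S) := ProjMod {
  proj_val :> module B;
  proj_valP : mod_projective proj_val
}.

HB.instance Definition _ (S : comNzRingType) (B : freeAlg S) :=
  gen_eqMixin (module B).
HB.instance Definition _ (S : comNzRingType) (B : freeAlg S) :=
  gen_choiceMixin (module B).
HB.instance Definition _ (S : comNzRingType) (B : freeAlg S) :=
  gen_eqMixin (projmod B).
HB.instance Definition _ (S : comNzRingType) (B : freeAlg S) :=
  gen_choiceMixin (projmod B).

Section ModuleTheory.
Variables (S : comNzRingType) (B : freeAlg S).
Implicit Types (V W : module B).

Lemma mactD V (a b : B) : mact V (a + b) = mact V a + mact V b.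
Proof. by rewrite -[a in LHS]mul1r -(rmorph1 (ascal B)) mact_lin scale1r. Qed.

Lemma mact0 V : mact V 0 = 0.
Proof. by apply: (@addIr _ (mact V 0)); rewrite -mactD !add0r. Qed.

Lemma mactZ V s (a : B) : mact V (ascal B s * a) = s *: mact V a.
Proof. by rewrite -[X in mact V X]addr0 mact_lin mact0 addr0. Qed.

Lemma mactE V (a : B) : mact V a = \sum_i acoord a 0 i *: mact V (abasis i).
Proof.
rewrite {1}(abasis_sum a) (big_morph (mact V) (mactD V) (mact0 V)).
by apply: eq_bigr => i _; rewrite mactZ.
Qed.

Lemma mod_hom_basis V W (X : 'M[S]_(mdim W, mdim V)) :
  (forall i, mact W (abasis i) *m X = X *m mact V (abasis i)) -> mod_hom X.
Proof.
move=> hX b; rewrite (mactE W b) (mactE V b) mulmx_suml mulmx_sumr.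
by apply: eq_bigr => i _; rewrite -scalemxAl hX -scalemxAr.
Qed.

Lemma mod_hom1 V : @mod_hom S B V V 1%:M.
Proof. by move=> b; rewrite mulmx1 mul1mx. Qed.

Lemma mod_hom_comp U V W (X : 'M_(mdim W, mdim V)) (Y : 'M_(mdim V, mdim U)) :
  mod_hom X -> mod_hom Y -> mod_hom (X *m Y).
Proof. by move=> hX hY b; rewrite mulmxA hX -mulmxA hY mulmxA. Qed.

End ModuleTheory.

Section ColumnwiseLinear.
Variable S : comNzRingType.

Lemma eq_colP m n (X Y : 'M[S]_(m, n)) :
  (forall j, col j X = col j Y) -> X = Y.
Proof.
by move=> XY; apply/matrixP => i j; have /colP/(_ i) := XY j; rewrite !mxE.
Qed.

Lemma col_mul m n p (X : 'M[S]_(m, n)) (Y : 'M[S]_(n, p)) j :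
  col j (X *m Y) = X *m col j Y.
Proof. by rewrite !colE mulmxA. Qed.

Lemma col_solve m n p (X : 'M[S]_(m, n)) (Z : 'M[S]_(m, p)) :
  (forall j, exists u : 'cV_n, col j Z = X *m u) -> exists N, Z = X *m N.
Proof.
move=> /(fun h => choice h)[f hf]; exists (\matrix_(i, j) f j i 0).
apply: eq_colP => j; rewrite col_mul hf; congr (_ *m _).
by apply/colP => i; rewrite !mxE.
Qed.

(* A short exact sequence splits over S. *)
Lemma exact_split p m n (X : 'M[S]_(m, p)) (Y : 'M[S]_(n, m)) :
    (forall u : 'cV_p, X *m u = 0 -> u = 0) ->
    (forall w : 'cV_n, exists v : 'cV_m, w = Y *m v) ->
    (forall v : 'cV_m, Y *m v = 0 <-> exists u : 'cV_p, v = X *m u) ->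
  exists (N : 'M[S]_(p, m)) (T : 'M[S]_(m, n)),
    [/\ Y *m X = 0, Y *m T = 1%:M, N *m X = 1%:M & X *m N + T *m Y = 1%:M].
Proof.
move=> Xinj Ysurj YX.
have YX0 : Y *m X = 0.
  apply: eq_colP => j; rewrite col_mul linear0.
  by apply/YX; exists (delta_mx j 0); rewrite colE.
have [T YT] : exists T, 1%:M = Y *m T by apply: col_solve => j; apply: Ysurj.
have [N XN] : exists N, 1%:M - T *m Y = X *m N.
  apply: col_solve => j; apply/YX.
  by rewrite -col_mul mulmxBr mulmx1 mulmxA -YT mul1mx subrr linear0.
exists N, T; split=> //; last by rewrite -XN subrK.
apply: eq_colP => j; apply/eqP; rewrite -subr_eq0 -linearB; apply/eqP; apply: Xinj.
rewrite -col_mul mulmxBr mulmxA -XN mulmxBl -(mulmxA T) YX0 mulmx0 mulmx1 mul1mx.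
by rewrite subr0 subrr linear0.
Qed.

Lemma split_exact p m n (X : 'M[S]_(m, p)) (Y : 'M[S]_(n, m)) N T :
    Y *m X = 0 -> Y *m T = 1%:M -> N *m X = 1%:M ->
    X *m N + T *m Y = 1%:M ->
  [/\ forall u : 'cV_p, X *m u = 0 -> u = 0,
      forall w : 'cV_n, exists v : 'cV_m, w = Y *m v &
      forall v : 'cV_m, Y *m v = 0 <-> exists u : 'cV_p, v = X *m u].
Proof.
move=> YX YT NX XN; split=> [u Xu|w|v].
- by rewrite -[u]mul1mx -NX -mulmxA Xu mulmx0.
- by exists (T *m w); rewrite mulmxA YT mul1mx.
split=> [Yv|[u ->]]; last by rewrite mulmxA YX mul0mx.
exists (N *m v); rewrite -[v in LHS]mul1mx -XN mulmxDl -!mulmxA Yv mulmx0.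
by rewrite addr0.
Qed.

End ColumnwiseLinear.

Section HomDim.
Variables (F : fieldType) (B : freeAlg F).
Implicit Types (V W P : module B).

Definition homv V W : {vspace 'M[F]_(mdim W, mdim V)} :=
  (\bigcap_(i < arank B)
    lker (linfun (mulmx (mact W (abasis i))) -
          linfun (mulmxr (mact V (abasis i)))))%VS.

Lemma homvP V W X : reflect (mod_hom X) (X \in homv V W).
Proof.
apply: (iffP idP) => [hX|hX].
  apply: mod_hom_basis => i; move: hX; rewrite memvE.
  move/subv_bigcapP/(_ i isT); rewrite -memvE => /eqlfunP.
  by rewrite !lfunE.
rewrite memvE; apply/subv_bigcapP => i _; rewrite -memvE.
apply/eqlfunP; rewrite !lfunE; exact: hX.
Qed.

Definition hom_dim V W : nat := \dim (homv V W).

Lemma hom_dim_exact_r P V V' V'' : mod_projective P ->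
  short_exact V V' V'' -> hom_dim P V = (hom_dim P V' + hom_dim P V'')%N.
Proof.
move=> projP [X [Y [hX hY Xinj Ysurj YX]]].
have [N [T [YX0 YT NX XN]]] := exact_split Xinj Ysurj YX.
rewrite /hom_dim -(limg_ker_dim (linfun (mulmx Y)) (homv P V)).
congr (_ + _)%N; last first.
  congr (\dim _); apply/vspaceP => Z; apply/memv_imgP/homvP => [[W /homvP hW ->]|hZ].
    by rewrite lfunE; apply: mod_hom_comp.
  have [H hH YH] := projP _ _ _ _ hY hZ Ysurj.
  by exists H; [apply/homvP | rewrite lfunE].
rewrite -(@limg_dim_eq _ _ _ (linfun (mulmx X)) (homv P V')).
  congr (\dim _); apply/vspaceP => Z; rewrite memv_cap memv_ker lfunE /=.
  apply/andP/memv_imgP => [[/homvP hZ /eqP YZ]|[W /homvP hW ->]].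
    have XNZ : Z = X *m (N *m Z).
      by rewrite -[Z in LHS]mul1mx -XN mulmxDl -!mulmxA YZ mulmx0 addr0.
    exists (N *m Z); last by rewrite lfunE.
    apply/homvP => b; rewrite -[LHS]mul1mx -[RHS]mul1mx -NX -!mulmxA.
    congr (N *m _); rewrite mulmxA -hX -mulmxA -XNZ hZ.
    by rewrite [in RHS](mulmxA N) (mulmxA X) -XNZ.
  rewrite lfunE /= mulmxA YX0 mul0mx eqxx; split=> //.
  by apply/homvP/mod_hom_comp.
apply/eqP; rewrite -subv0; apply/subvP => Z; rewrite memv_cap memv_ker lfunE /=.
move=> /andP[_ /eqP XZ]; rewrite memv0 -[Z]mul1mx -NX -mulmxA XZ mulmx0 //.
Qed.

Lemma hom_dim_exact_l V P P' P'' : mod_projective P'' ->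
  short_exact P P' P'' -> hom_dim P V = (hom_dim P' V + hom_dim P'' V)%N.
Proof.
move=> projP [X [Y [hX hY Xinj Ysurj YX]]].
have [N0 [T0 [YX0 YT0 NX0 XN0]]] := exact_split Xinj Ysurj YX.
have [T hT YT] := projP _ _ _ _ hY (mod_hom1 P'') Ysurj.
pose N := N0 *m (1%:M - T *m Y).
have XN : X *m N = 1%:M - T *m Y.
  rewrite /N mulmxA (_ : X *m N0 = 1%:M - T0 *m Y); last by rewrite -XN0 addrK.
  rewrite mulmxBl mul1mx -mulmxA mulmxBr mulmx1 (mulmxA Y) YT mul1mx subrr.
  by rewrite mulmx0 subr0.
have NX : N *m X = 1%:M.
  by rewrite /N -mulmxA mulmxBl mul1mx -mulmxA YX0 mulmx0 subr0.
clearbody N; have hN : mod_hom N.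
  move=> b; rewrite -[LHS]mul1mx -[RHS]mul1mx -NX -!mulmxA; congr (N *m _).
  rewrite mulmxA -hX -mulmxA XN [in RHS](mulmxA X) XN mulmxBr mulmx1 mulmxBl.
  by rewrite mul1mx mulmxA hT -!mulmxA hY.
rewrite /hom_dim addnC -(limg_ker_dim (linfun (mulmxr X)) (homv P V)).
congr (_ + _)%N; last first.
  congr (\dim _); apply/vspaceP => Z; apply/memv_imgP/homvP => [[W /homvP hW ->]|hZ].
    by rewrite lfunE; apply: mod_hom_comp.
  exists (Z *m N); first exact/homvP/mod_hom_comp.
  by rewrite lfunE /= -mulmxA NX mulmx1.
rewrite -(@limg_dim_eq _ _ _ (linfun (mulmxr Y)) (homv P'' V)).
  congr (\dim _); apply/vspaceP => Z; rewrite memv_cap memv_ker lfunE /=.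
  apply/andP/memv_imgP => [[/homvP hZ /eqP ZX]|[W /homvP hW ->]].
    exists (Z *m T); first exact/homvP/mod_hom_comp.
    rewrite lfunE /= -mulmxA.
    have -> : T *m Y = 1%:M - X *m N by rewrite XN opprB addrC subrK.
    by rewrite mulmxBr mulmx1 mulmxA ZX mul0mx subr0.
  rewrite lfunE /= -mulmxA YX0 mulmx0 eqxx; split=> //.
  by apply/homvP/mod_hom_comp.
apply/eqP; rewrite -subv0; apply/subvP => Z; rewrite memv_cap memv_ker lfunE /=.
by move=> /andP[_ /eqP ZY]; rewrite memv0 -[Z]mulmx1 -YT mulmxA ZY mul0mx.
Qed.

End HomDim.

(* The group generated by T subject to [V] = [V'] + [V''] whenever E V V' V''. *)
Section Grothendieck.
Variables (T : choiceType) (E : T -> T -> T -> Prop).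

Inductive groth_rel : {freeg T} -> Prop :=
| GrothRel0 : groth_rel 0
| GrothRelB x y : groth_rel x -> groth_rel y -> groth_rel (x - y)
| GrothRelE V V' V'' : E V V' V'' ->
    groth_rel (<< V >> - (<< V' >> + << V'' >>)).

Definition groth_pred (x : {freeg T}) : bool := `[< groth_rel x >].

Lemma groth_pred_closed : zmod_closed groth_pred.
Proof.
split=> [|x y /asboolP hx /asboolP hy]; apply/asboolP.
  exact: GrothRel0.
exact: GrothRelB.
Qed.

HB.instance Definition _ :=
  GRing.isZmodClosed.Build {freeg T} groth_pred groth_pred_closed.

Definition groth_sub := GRing.ZmodClosed.clone {freeg T} groth_pred _.

Definition groth : Type := {ideal_quot groth_sub}.

HB.instance Definition _ := GRing.Zmodule.on groth.

Definition gclass (V : T) : groth := \pi_({ideal_quot groth_sub})%qT << V >>.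

Definition exact_additive (Z : zmodType) (f : T -> Z) : Prop :=
  forall V V' V'', E V V' V'' -> f V = f V' + f V''.

Section Lift.
Variables (Z : zmodType) (f : T -> Z).
Hypothesis f_exact : exact_additive f.

Let flift : {freeg T} -> Z := @fglift int (zmodule Z) T f.

Lemma flift_is_zmod : zmod_morphism flift.
Proof. by move=> x y; apply: (@lift_is_additive int T (zmodule Z) f x y). Qed.

Lemma flift_gen V : flift << V >> = f V.
Proof. by rewrite /flift liftU scale1r. Qed.

Lemma flift_rel x : groth_rel x -> flift x = 0.
Proof.
elim=> [|y z _ hy _ hz|V V' V'' hV].
- by have := flift_is_zmod 0 0; rewrite !subrr.
- by rewrite flift_is_zmod hy hz subrr.
have fD : flift (<< V' >> + << V'' >>) = f V' + f V''.
  have := flift_is_zmod (<< V' >> + << V'' >>) << V'' >>.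
  by rewrite addrK !flift_gen => ->; rewrite subrK.
by rewrite flift_is_zmod fD flift_gen (f_exact hV) subrr.
Qed.

Definition glift (x : groth) : Z := flift (repr (x : {ideal_quot groth_sub})).

Lemma glift_pi (x : {freeg T}) :
  glift (\pi_({ideal_quot groth_sub})%qT x) = flift x.
Proof.
apply/eqP; rewrite -subr_eq0 /glift -flift_is_zmod; apply/eqP/flift_rel/asboolP.
by have /eqP := reprK (\pi_({ideal_quot groth_sub})%qT x);
  rewrite -Quotient.idealrBE.
Qed.

Lemma glift_is_zmod : zmod_morphism glift.
Proof.
elim/quotW=> x; elim/quotW=> y.
rewrite !glift_pi -flift_is_zmod -glift_pi; congr glift.
exact: esym (raddfB (\pi_({ideal_quot groth_sub})%qT) x y).
Qed.

Lemma glift_gclass V : glift (gclass V) = f V.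
Proof. by rewrite glift_pi flift_gen. Qed.

End Lift.

(* The morphism groth -> Z induced by a map that is additive on exact triples;
   [gmorphE] gives its values on classes. *)
Definition gmorph (Z : zmodType) (f : T -> Z)
    (f_exact : exact_additive f) : groth -> Z := glift f.

HB.instance Definition _ (Z : zmodType) (f : T -> Z)
    (f_exact : exact_additive f) :=
  GRing.isZmodMorphism.Build groth Z (gmorph f_exact) (glift_is_zmod f_exact).

Lemma gmorphE (Z : zmodType) (f : T -> Z) f_exact V :
  @gmorph Z f f_exact (gclass V) = f V.
Proof. exact: glift_gclass. Qed.

Lemma gmorphD (Z : zmodType) (f g h : T -> Z) fE gE hE :
    (forall V, f V = g V + h V) ->
  forall x, @gmorph Z f fE x = @gmorph Z g gE x + @gmorph Z h hE x.
Proof.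
move=> fgh x; rewrite /gmorph /glift; set y := repr _.
rewrite -[y]freeg_repr !fglift_Freeg /prelift -big_split /=.
by apply: eq_bigr => c _; rewrite fgh scalerDr.
Qed.

Lemma gclass_exact V V' V'' : E V V' V'' -> gclass V = gclass V' + gclass V''.
Proof.
move=> hV; apply/eqP.
rewrite /gclass -(raddfD (\pi_({ideal_quot groth_sub})%qT)).
by rewrite -Quotient.idealrBE; apply/asboolP/GrothRelE.
Qed.

End Grothendieck.

Arguments gclass {T E} V.

Section GrothendieckAlg.
Variables (F : fieldType) (B : freeAlg F).

Definition G0 : Type := groth (@short_exact F B).

Definition proj_exact (P P' P'' : projmod B) : Prop := short_exact P P' P''.

Definition K0 : Type := groth proj_exact.

HB.instance Definition _ := GRing.Zmodule.on G0.
HB.instance Definition _ := GRing.Zmodule.on K0.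

Definition G0cl (V : module B) : G0 := gclass V.
Definition K0cl (P : projmod B) : K0 := gclass P.

Lemma cartan_exact (P P' P'' : projmod B) :
  proj_exact P P' P'' -> G0cl P = G0cl P' + G0cl P''.
Proof. exact: (@gclass_exact _ (@short_exact F B)). Qed.

Definition cartan : {additive K0 -> G0} := gmorph cartan_exact.

Lemma pair_exact_r (P : projmod B) (V V' V'' : module B) :
    short_exact V V' V'' ->
  (hom_dim P V)%:Z = (hom_dim P V')%:Z + (hom_dim P V'')%:Z.
Proof. by move/(hom_dim_exact_r (@proj_valP _ _ P)) ->. Qed.

Lemma pair_exact_l (y : G0) (P P' P'' : projmod B) :
    proj_exact P P' P'' ->
  gmorph (@pair_exact_r P) y =
  gmorph (@pair_exact_r P') y + gmorph (@pair_exact_r P'') y.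
Proof.
move=> hP; apply: gmorphD => V.
by rewrite (hom_dim_exact_l _ (@proj_valP _ _ P'') hP).
Qed.

(* The biadditive form with <[P], [V]> = dim_F Hom_B(P, V). *)
Definition intertwining (x : K0) (y : G0) : int := gmorph (@pair_exact_l y) x.

Lemma intertwiningE (P : projmod B) (V : module B) :
  intertwining (K0cl P) (G0cl V) = (hom_dim P V)%:Z.
Proof. by rewrite /intertwining !gmorphE. Qed.

End GrothendieckAlg.

(* A ring morphism g : A -> End(S^d) that is semilinear along phi : R -> S
   extends to an S (x)_R A-module structure on S^d, with 1 (x) a acting by g. *)
Section BaseChangeModule.
Variables (R S : comNzRingType) (phi : {rmorphism R -> S}) (A : freeAlg R).
Variables (d : nat) (g : A -> 'M[S]_d).
Hypothesis g_lin : forall r (a b : A),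
  g (ascal A r * a + b) = phi r *: g a + g b.
Hypothesis g1 : g 1 = 1%:M.
Hypothesis gM : forall a b : A, g (a * b) = g a *m g b.

Definition bcact (x : bchange phi A) : 'M[S]_d :=
  \sum_(i < arank A) acoord x 0 i *: g (abasis i).

Lemma bcact_lin s (x y : bchange phi A) :
  bcact (ascal (bchange phi A) s * x + y) = s *: bcact x + bcact y.
Proof.
rewrite /bcact scaler_sumr -big_split /=; apply: eq_bigr => i _.
by rewrite bcscalE !mxE scalerDl scalerA.
Qed.

Lemma bcactD (x y : bchange phi A) : bcact (x + y) = bcact x + bcact y.
Proof.
by rewrite -[x in LHS]mul1r -(rmorph1 (ascal _)) bcact_lin scale1r.
Qed.

Lemma bcact0 : bcact 0 = 0.
Proof. by apply: (@addIr _ (bcact 0)); rewrite -bcactD !add0r. Qed.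

Lemma bcactZ s (x : bchange phi A) : bcact (bcscale s x) = s *: bcact x.
Proof. by rewrite -[X in bcact X]addr0 -bcscalE bcact_lin bcact0 addr0. Qed.

Lemma bcact_in (a : A) : bcact (bcin phi a) = g a.
Proof.
have gD (b c : A) : g (b + c) = g b + g c.
  by rewrite -[b in LHS]mul1r -(rmorph1 (ascal A)) g_lin rmorph1 scale1r.
have g0 : g 0 = 0 by apply: (@addIr _ (g 0)); rewrite -gD !add0r.
have gZ r (b : A) : g (ascal A r * b) = phi r *: g b.
  by have := g_lin r b 0; rewrite !addr0 g0 addr0.
rewrite {2}(abasis_sum a) (big_morph g gD g0); apply: eq_bigr => i _.
by rewrite gZ /= mxE.
Qed.

Lemma bcact1 : bcact 1 = 1%:M.
Proof. by rewrite -g1 -bcact_in. Qed.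

Lemma bcactM (x y : bchange phi A) : bcact (x * y) = bcact x *m bcact y.
Proof.
elim/bc_ind: x => [|u v IHu IHv|s a].
- by rewrite mul0r bcact0 mul0mx.
- by rewrite mulrDl !bcactD mulmxDl IHu IHv.
rewrite [_ * _]bcmulZl !bcactZ -scalemxAl; congr (_ *: _).
elim/bc_ind: y => [|u v IHu IHv|t b].
- by rewrite [bcmul _ _](bcmul0 _) bcact0 mulmx0.
- by rewrite bcmulDr !bcactD mulmxDr IHu IHv.
by rewrite bcmulZr !bcactZ -scalemxAr bcmul_in !bcact_in gM.
Qed.

Definition bcmodule : module (bchange phi A) :=
  Module bcact_lin bcact1 bcactM.

End BaseChangeModule.

(* V^F' = F' (x)_F V, for a B-module V and an extension F' of F. *)
Section ScalarExtension.
Variables (F F' : comNzRingType) (iota : {rmorphism F -> F'}).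
Variables (B : freeAlg F) (V : module B).

Let g (b : B) := map_mx iota (mact V b).

Lemma mod_ext_lin r (a b : B) : g (ascal B r * a + b) = iota r *: g a + g b.
Proof. by rewrite /g mact_lin map_mxD map_mxZ. Qed.

Lemma mod_ext1 : g 1 = 1%:M.
Proof. by rewrite /g mact1 map_mx1. Qed.

Lemma mod_extM (a b : B) : g (a * b) = g a *m g b.
Proof. by rewrite /g mactM map_mxM. Qed.

Definition mod_ext : module (bchange iota B) :=
  bcmodule mod_ext_lin mod_ext1 mod_extM.

End ScalarExtension.

Definition mod_simple (F : fieldType) (B : freeAlg F) (V : module B) : Prop :=
  (0 < mdim V)%N /\
  forall U : {vspace 'cV[F]_(mdim V)},
    (forall (b : B) v, v \in U -> mact V b *m v \in U) ->
    U = 0%VS \/ U = fullv.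

Definition split_alg (F : fieldType) (B : freeAlg F) : Prop :=
  forall (F' : fieldType) (iota : {rmorphism F -> F'}) (V : module B),
    mod_simple V -> mod_simple (mod_ext iota V).

(* S' (x)_S W as a module over S' (x)_S (S (x)_R A) = S' (x)_R A, for a module W
   over S (x)_R A and morphisms phi : R -> S, psi : S -> S'. *)
Section TowerExtension.
Variables (R S S' : comNzRingType) (phi : {rmorphism R -> S}).
Variables (phi' : {rmorphism R -> S'}) (psi : {rmorphism S -> S'}).
Hypothesis psi_phi : forall r, psi (phi r) = phi' r.
Variables (A : freeAlg R) (W : module (bchange phi A)).

Let g (a : A) := map_mx psi (mact W (bcin phi a)).

Lemma mod_tower_lin r (a b : A) : g (ascal A r * a + b) = phi' r *: g a + g b.
Proof.
by rewrite /g bcinD bcinZ -bcscalE mact_lin map_mxD map_mxZ /= psi_phi.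
Qed.

Lemma mod_tower1 : g 1 = 1%:M.
Proof. by rewrite /g [bcin _ _](erefl (1 : bchange phi A)) mact1 map_mx1. Qed.

Lemma mod_towerM (a b : A) : g (a * b) = g a *m g b.
Proof. by rewrite /g -bcmul_in mactM map_mxM. Qed.

Definition mod_tower : module (bchange phi' A) :=
  bcmodule mod_tower_lin mod_tower1 mod_towerM.

End TowerExtension.

Section ScalarExtensionG0.
Variables (R : comNzRingType) (k k' : fieldType) (phi : {rmorphism R -> k}).
Variables (phi' : {rmorphism R -> k'}) (psi : {rmorphism k -> k'}).
Hypothesis psi_phi : forall r, psi (phi r) = phi' r.
Variable A : freeAlg R.

Lemma mod_tower_hom (V W : module (bchange phi A)) X :
  @mod_hom _ _ V W X ->
  @mod_hom _ _ (mod_tower psi_phi V) (mod_tower psi_phi W) (map_mx psi X).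
Proof.
move=> hX x; rewrite mulmx_suml mulmx_sumr; apply: eq_bigr => i _.
by rewrite -scalemxAl -scalemxAr -!map_mxM hX.
Qed.

Lemma mod_tower_exact (V V' V'' : module (bchange phi A)) :
  short_exact V V' V'' ->
  short_exact (mod_tower psi_phi V) (mod_tower psi_phi V') (mod_tower psi_phi V'').
Proof.
move=> [X [Y [hX hY Xinj Ysurj YX]]].
have [N [T [YX0 YT NX XN]]] := exact_split Xinj Ysurj YX.
have [? ? ?] : [/\ forall u : 'cV_(mdim V'), map_mx psi X *m u = 0 -> u = 0,
    forall w : 'cV_(mdim V''), exists v : 'cV_(mdim V), w = map_mx psi Y *m v &
    forall v : 'cV_(mdim V), map_mx psi Y *m v = 0 <->
      exists u : 'cV_(mdim V'), v = map_mx psi X *m u].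
  apply: (@split_exact _ _ _ _ _ _ (map_mx psi N) (map_mx psi T)).
  - by rewrite -map_mxM YX0 map_mx0.
  - by rewrite -map_mxM YT map_mx1.
  - by rewrite -map_mxM NX map_mx1.
  by rewrite -!map_mxM -map_mxD XN map_mx1.
by exists (map_mx psi X), (map_mx psi Y); split=> //; apply: mod_tower_hom.
Qed.

Lemma G0_ext_exact (V V' V'' : module (bchange phi A)) :
    short_exact V V' V'' ->
  G0cl (mod_tower psi_phi V) =
  G0cl (mod_tower psi_phi V') + G0cl (mod_tower psi_phi V'').
Proof. by move/mod_tower_exact/(@gclass_exact _ (@short_exact _ _)). Qed.

Definition G0_ext : {additive G0 (bchange phi A) -> G0 (bchange phi' A)} :=
  gmorph G0_ext_exact.

Lemma G0_extE (V : module (bchange phi A)) :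
  G0_ext (G0cl V) = G0cl (mod_tower psi_phi V).
Proof. exact: gmorphE. Qed.

End ScalarExtensionG0.

(* The residue ring R/p at a prime ideal, as an integral domain. *)
Section PrimeQuotient.
Variables (R : comNzRingType) (p : prime_idealr R).

Definition prime_quot : Type := {ideal_quot p}.

HB.instance Definition _ := GRing.ComNzRing.on prime_quot.

Definition prime_quot_unit (x : prime_quot) : bool := `[< exists y, y * x = 1 >].

Definition prime_quot_inv (x : prime_quot) : prime_quot :=
  if pselect (exists y, y * x = 1) is left h then sval (cid h) else x.

Lemma prime_quot_mulVx :
  {in prime_quot_unit, left_inverse 1 prime_quot_inv *%R}.
Proof.
move=> x /asboolP hx; rewrite /prime_quot_inv.
by case: pselect => // h; apply: svalP (cid h).
Qed.

Lemma prime_quot_unitPl (x y : prime_quot) : y * x = 1 -> prime_quot_unit x.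
Proof. by move=> yx; apply/asboolP; exists y. Qed.

Lemma prime_quot_inv_out :
  {in [predC prime_quot_unit], prime_quot_inv =1 id}.
Proof.
move=> x /negP hx; rewrite /prime_quot_inv; case: pselect => // h.
by case: hx; apply/asboolP.
Qed.

HB.instance Definition _ := GRing.ComNzRing_hasMulInverse.Build prime_quot
  prime_quot_mulVx prime_quot_unitPl prime_quot_inv_out.

HB.instance Definition _ := GRing.ComUnitRing_isIntegral.Build prime_quot
  (@Quotient.rquot_IdomainAxiom R p).

Definition prime_proj (x : R) : prime_quot := \pi_({ideal_quot p})%qT x.

Lemma prime_proj_is_zmod : zmod_morphism prime_proj.
Proof. exact: raddfB. Qed.

Lemma prime_proj_is_monoid : monoid_morphism prime_proj.
Proof. by split; [exact: rmorph1 | exact: rmorphM]. Qed.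

HB.instance Definition _ := GRing.isZmodMorphism.Build R prime_quot prime_proj
  prime_proj_is_zmod.
HB.instance Definition _ := GRing.isMonoidMorphism.Build R prime_quot prime_proj
  prime_proj_is_monoid.

Lemma prime_proj_eq0 x : (prime_proj x == 0) = (x \in p).
Proof.
rewrite -[in RHS](subr0 x) Quotient.idealrBE.
by rewrite /prime_proj -[0](rmorph0 (\pi_({ideal_quot p})%qT)).
Qed.

(* k(p) = Frac(R/p) *)
Definition kappa : fieldType := {fraction prime_quot}.

Definition kappa_map : {rmorphism R -> kappa} := @tofrac prime_quot \o prime_proj.

End PrimeQuotient.

(* The extension to Frac(D) of an injective morphism from D to a field. *)
Section FractionLift.
Variables (D : idomainType) (K : fieldType) (g : {rmorphism D -> K}).
Hypothesis g_inj : forall x, g x = 0 -> x = 0.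

Definition frac_lift (x : {fraction D}) : K :=
  let r := repr x in g (frac r).1 / g (frac r).2.

Lemma g_neq0 x : x != 0 -> g x != 0.
Proof. by apply: contra_neq => /g_inj. Qed.

Lemma frac_repr (x : {fraction D}) :
  exists a b : D, [/\ b != 0, x = tofrac a / tofrac b & frac_lift x = g a / g b].
Proof.
exists (frac (repr x)).1, (frac (repr x)).2; split=> //; first exact: denom_ratioP.
have d0 : tofrac (frac (repr x)).2 != 0 by rewrite tofrac_eq0 denom_ratioP.
apply: (mulIf d0); rewrite divfK //; set r := repr x.
rewrite -[x in LHS]reprK -/r; unlock tofrac; rewrite -[LHS]FracField.pi_mul.
apply/eqmodP; rewrite /= FracField.equivfE /FracField.mulf.
by rewrite !numden_Ratio ?mulr1 ?oner_neq0 ?denom_ratioP // mulrC.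
Qed.

Lemma frac_liftE a b : b != 0 -> frac_lift (tofrac a / tofrac b) = g a / g b.
Proof.
move=> b0; have [c [d [d0 /eqP + ->]]] := frac_repr (tofrac a / tofrac b).
rewrite eqr_div ?tofrac_eq0 // -!rmorphM tofrac_eq => /eqP adcb.
by apply/eqP; rewrite eqr_div ?g_neq0 // -!rmorphM adcb.
Qed.

Lemma frac_lift_is_zmod : zmod_morphism frac_lift.
Proof.
move=> x y; have [a [b [b0 -> ->]]] := frac_repr x.
have [c [d [d0 -> ->]]] := frac_repr y.
rewrite -!mulNr -!rmorphN !addf_div ?tofrac_eq0 ?g_neq0 //.
by rewrite -!rmorphM -!rmorphD frac_liftE ?mulf_neq0.
Qed.

Lemma frac_lift_is_monoid : monoid_morphism frac_lift.
Proof.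
split=> [|x y].
  by rewrite -[1]divr1 -(rmorph1 (@tofrac D)) frac_liftE ?oner_neq0 // rmorph1 divr1.
have [a [b [b0 -> ->]]] := frac_repr x; have [c [d [d0 -> ->]]] := frac_repr y.
by rewrite !mulf_div -!rmorphM frac_liftE ?mulf_neq0.
Qed.

End FractionLift.

Definition frac_mor (D : idomainType) (K : fieldType) (g : {rmorphism D -> K})
    (g_inj : forall x, g x = 0 -> x = 0) : {fraction D} -> K := frac_lift g.

HB.instance Definition _ (D : idomainType) (K : fieldType)
    (g : {rmorphism D -> K}) (g_inj : forall x, g x = 0 -> x = 0) :=
  GRing.isZmodMorphism.Build {fraction D} K (frac_mor g_inj)
    (frac_lift_is_zmod g_inj).
HB.instance Definition _ (D : idomainType) (K : fieldType)
    (g : {rmorphism D -> K}) (g_inj : forall x, g x = 0 -> x = 0) :=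
  GRing.isMonoidMorphism.Build {fraction D} K (frac_mor g_inj)
    (frac_lift_is_monoid g_inj).

Lemma frac_mor_tofrac (D : idomainType) (K : fieldType)
    (g : {rmorphism D -> K}) (g_inj : forall x, g x = 0 -> x = 0) a :
  frac_mor g_inj (tofrac a) = g a.
Proof.
by have := frac_liftE g_inj a (oner_neq0 D); rewrite !rmorph1 !divr1.
Qed.

(* A (normalized) discrete valuation of K; the value at 0 is irrelevant.  The
   discrete valuation rings with fraction field K are the [valring v]. *)
Record discrete_valuation (K : fieldType) := DiscreteValuation {
  dval :> K -> int;
  dvalM : forall x y, x != 0 -> y != 0 -> dval (x * y) = dval x + dval y;
  dvalD : forall x y, x != 0 -> y != 0 -> x + y != 0 ->
    Order.min (dval x) (dval y) <= dval (x + y);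
  dval_surj : forall n : int, exists2 x, x != 0 & dval x = n
}.

Section ValuationRing.
Variables (K : fieldType) (v : discrete_valuation K).

Definition in_valring : pred K := fun x => (x == 0) || (0 <= v x).

Definition in_valmax : pred K := fun x => (x == 0) || (0 < v x).

Lemma dval1 : v 1 = 0.
Proof.
by apply: (@addrI _ (v 1)); rewrite -dvalM ?oner_neq0 // mulr1 addr0.
Qed.

Lemma dvalN1 : v (-1) = 0.
Proof.
have N1 : (-1 : K) != 0 by rewrite oppr_eq0 oner_neq0.
have := dvalM v N1 N1; rewrite mulrNN mulr1 dval1 => /esym/eqP.
by rewrite -mulr2n mulrn_eq0 => /eqP.
Qed.

Lemma dvalN x : v (- x) = v x.
Proof.
have [->|x0] := eqVneq x 0; first by rewrite oppr0.
by rewrite -mulN1r dvalM ?oppr_eq0 ?oner_neq0 // dvalN1 add0r.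
Qed.

Lemma in_valringE x : (x \in in_valring) = (x == 0) || (0 <= v x).
Proof. by []. Qed.

Lemma in_valmaxE x : (x \in in_valmax) = (x == 0) || (0 < v x).
Proof. by []. Qed.

Lemma valring_subring : subring_closed in_valring.
Proof.
split=> [|x y|x y]; rewrite !in_valringE.
- by rewrite dval1 lexx orbT.
- have [->|x0] := eqVneq x 0; first by rewrite add0r oppr_eq0 dvalN.
  have [->|y0] := eqVneq y 0; first by rewrite subr0 (negPf x0).
  have [//|xy0] /= := eqVneq (x - y) 0 => vx vy.
  apply: le_trans (dvalD v x0 _ xy0); last by rewrite oppr_eq0.
  by rewrite le_min vx dvalN.
have [->|x0] := eqVneq x 0; first by rewrite mul0r eqxx.
have [->|y0] := eqVneq y 0; first by rewrite mulr0 eqxx.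
by rewrite /= dvalM // => vx vy; rewrite addr_ge0 ?orbT.
Qed.

HB.instance Definition _ :=
  GRing.isSubringClosed.Build K in_valring valring_subring.

Definition valring : Type := {x : K | in_valring x}.

HB.instance Definition _ := SubType.on valring.
HB.instance Definition _ := [Choice of valring by <:].
HB.instance Definition _ := [SubChoice_isSubComNzRing of valring by <:].

Definition valring_map : {rmorphism valring -> K} := (\val : valring -> K).

Definition valmax : pred valring := fun x => in_valmax (\val x).

Lemma valmaxE x : (x \in valmax) = (\val x == 0) || (0 < v (\val x)).
Proof. by []. Qed.

Lemma in_valmax_lin a x y :
  in_valring a -> in_valmax x -> in_valmax y -> in_valmax (a * x + y).
Proof.
rewrite /in_valring /in_valmax => va vx vy.
have {va} vx : (a * x == 0) || (0 < v (a * x)).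
  have [->|a0] := eqVneq a 0; first by rewrite mul0r eqxx.
  have [->|x0] := eqVneq x 0; first by rewrite mulr0 eqxx.
  move: va vx; rewrite (negPf a0) (negPf x0) /= => va vx.
  by rewrite dvalM // ltr_wpDl ?orbT.
move: (a * x) vx => {}x; have [->|x0] := eqVneq x 0; first by rewrite add0r.
move: vy; have [->|y0] := eqVneq y 0; first by rewrite addr0 (negPf x0).
have [//|xy0] /= := eqVneq (x + y) 0 => vy vx.
by apply: lt_le_trans (dvalD v x0 y0 xy0); rewrite lt_min vx.
Qed.

Lemma in_valmax_prime x y :
    in_valring x -> in_valring y -> in_valmax (x * y) ->
  in_valmax x || in_valmax y.
Proof.
rewrite /in_valring /in_valmax mulf_eq0.
have [//|x0] := eqVneq x 0; have [|y0] /= := eqVneq y 0; first by rewrite orbT.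
rewrite dvalM // !le_eqVlt => /orP[/eqP <-|->] //.
by rewrite add0r => _ ->; rewrite orbT.
Qed.

Lemma valmax_ideal : idealr_closed valmax.
Proof.
split=> [||a x y]; rewrite ?valmaxE.
- by rewrite rmorph0 eqxx.
- by rewrite rmorph1 oner_eq0 dval1 ltxx.
exact: in_valmax_lin (valP a).
Qed.

Lemma valmax_prime : prime_idealr_closed valmax.
Proof. by move=> x y; apply: in_valmax_prime; [exact: valP|exact: valP]. Qed.

HB.instance Definition _ := isIdealr.Build valring valmax valmax_ideal.
HB.instance Definition _ := isPrimeIdealrClosed.Build valring valmax valmax_prime.

Definition valmax_prime_ideal : prime_idealr valring :=
  PrimeIdealr.clone valring valmax _.

(* The residue field O/m. *)
Definition residue_field : Type := prime_quot valmax_prime_ideal.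

HB.instance Definition _ := GRing.IntegralDomain.on residue_field.

Lemma residue_fieldP : GRing.field_axiom residue_field.
Proof.
move=> x; rewrite -[x]reprK; move: (repr x) => {x} a.
have -> : (\pi a)%qT = prime_proj valmax_prime_ideal a by [].
rewrite prime_proj_eq0 => am.
have [a0 va] : val a != 0 /\ v (val a) = 0.
  move: am (valP a : in_valring (val a)).
  rewrite [_ \in _]valmaxE negb_or -leNgt /in_valring => /andP[a0 va] /=.
  by rewrite (negPf a0) /= => va'; split=> //; apply/eqP; rewrite eq_le va va'.
have vi : in_valring (val a)^-1.
  have := dvalM v a0 (invr_neq0 a0); rewrite mulfV // dval1 va add0r.
  rewrite /in_valring => <-.
  by rewrite lexx orbT.
apply/asboolP; exists (prime_proj valmax_prime_ideal (Sub (val a)^-1 vi)).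
rewrite -rmorphM -(rmorph1 (prime_proj valmax_prime_ideal)).
by congr prime_proj; apply: val_inj; rewrite rmorphM /= mulVf.
Qed.

HB.instance Definition _ := GRing.UnitRing_isField.Build residue_field residue_fieldP.

Definition residue_map : {rmorphism valring -> residue_field} :=
  prime_proj valmax_prime_ideal.

End ValuationRing.

Arguments valmax {K} v x.

Section Gates.
Variables (R : idomainType) (p : prime_idealr R).

(* R_p and its maximal ideal, inside the fraction field of R. *)
Definition in_loc (x : {fraction R}) : Prop :=
  exists r s : R, s \notin p /\ x = tofrac r / tofrac s.

Definition in_locmax (x : {fraction R}) : Prop :=
  exists r s : R, [/\ r \in p, s \notin p & x = tofrac r / tofrac s].

(* The discrete valuation rings of Frac(R) that dominate R_p. *)
Record dominating_dvr := DominatingDvr {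
  dvr_val :> discrete_valuation {fraction R};
  dvr_loc : forall x, in_loc x -> in_valring dvr_val x;
  dvr_locmax : forall x, in_loc x -> in_valmax dvr_val x <-> in_locmax x
}.

Variable O : dominating_dvr.

Lemma in_loc_tofrac (r : R) : in_loc (tofrac r).
Proof. by exists r, 1; rewrite idealr1 rmorph1 divr1. Qed.

Lemma dvr_in_fact (r : R) : in_valring O (tofrac r).
Proof. exact/dvr_loc/in_loc_tofrac. Qed.

Lemma in_locmax_tofrac (r : R) : in_locmax (tofrac r) -> r \in p.
Proof.
move=> [a [s [ap sp]]] rE; have s0 : s != 0.
  by apply: contraNneq sp => ->; apply: idealr0.
have : r * s \in p.
  have /eqP : tofrac (r * s) = tofrac a by rewrite rmorphM /= rE divfK ?tofrac_eq0.
  by rewrite tofrac_eq => /eqP ->.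
by rewrite prime_idealrM (negPf sp) orbF.
Qed.

Definition dvr_in (r : R) : valring O := Sub (tofrac r) (dvr_in_fact r).

Lemma dvr_in_is_zmod : zmod_morphism dvr_in.
Proof. by move=> x y; apply: val_inj; rewrite /= !rmorphB. Qed.

Lemma dvr_in_is_monoid : monoid_morphism dvr_in.
Proof. by split=> [|x y]; apply: val_inj; rewrite /= ?rmorph1 ?rmorphM. Qed.

HB.instance Definition _ :=
  GRing.isZmodMorphism.Build R (valring O) dvr_in dvr_in_is_zmod.
HB.instance Definition _ :=
  GRing.isMonoidMorphism.Build R (valring O) dvr_in dvr_in_is_monoid.

Definition dvr_map : {rmorphism R -> valring O} := dvr_in.

Lemma dvr_in_max r : (dvr_in r \in valmax O) = (r \in p).
Proof.
have rloc := in_loc_tofrac r.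
apply/idP/idP => [/(dvr_locmax O rloc)|rp]; first exact: in_locmax_tofrac.
apply/(dvr_locmax O rloc); exists r, 1.
by rewrite idealr1 rmorph1 divr1.
Qed.

(* R -> O/m and the induced maps R/p -> O/m and k(p) -> k(m). *)
Definition dvr_residue : {rmorphism R -> residue_field O} :=
  residue_map O \o dvr_map.

Lemma dvr_residue_eq0 r : (dvr_residue r == 0) = (r \in p).
Proof. by rewrite -dvr_in_max [LHS]prime_proj_eq0. Qed.

Definition quot_residue (x : prime_quot p) : residue_field O :=
  dvr_residue (repr (x : {ideal_quot p})).

Lemma quot_residueE r : quot_residue (prime_proj p r) = dvr_residue r.
Proof.
apply/eqP; rewrite -subr_eq0 -rmorphB dvr_residue_eq0 Quotient.idealrBE.
by rewrite reprK.
Qed.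

Lemma prime_proj_surj (x : prime_quot p) : exists r, x = prime_proj p r.
Proof. by exists (repr (x : {ideal_quot p})); rewrite /prime_proj reprK. Qed.

Lemma quot_residue_is_zmod : zmod_morphism quot_residue.
Proof.
move=> x y; have [a ->] := prime_proj_surj x; have [b ->] := prime_proj_surj y.
by rewrite -rmorphB !quot_residueE rmorphB.
Qed.

Lemma quot_residue_is_monoid : monoid_morphism quot_residue.
Proof.
split=> [|x y]; first by rewrite -(rmorph1 (prime_proj p)) quot_residueE rmorph1.
have [a ->] := prime_proj_surj x; have [b ->] := prime_proj_surj y.
by rewrite -rmorphM !quot_residueE rmorphM.
Qed.

HB.instance Definition _ := GRing.isZmodMorphism.Build (prime_quot p)
  (residue_field O) quot_residue quot_residue_is_zmod.
HB.instance Definition _ := GRing.isMonoidMorphism.Build (prime_quot p)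
  (residue_field O) quot_residue quot_residue_is_monoid.

Lemma quot_residue_inj x : quot_residue x = 0 -> x = 0.
Proof.
have [r ->] := prime_proj_surj x; rewrite quot_residueE => /eqP.
by rewrite dvr_residue_eq0 -prime_proj_eq0 => /eqP.
Qed.

Definition kappa_residue : {rmorphism kappa p -> residue_field O} :=
  frac_mor quot_residue_inj.

Lemma kappa_residueE r : kappa_residue (kappa_map p r) = dvr_residue r.
Proof. by rewrite /= frac_mor_tofrac; apply: quot_residueE. Qed.

Lemma dvr_mapE r : valring_map O (dvr_map r) = tofrac r.
Proof. by []. Qed.

Variable A : freeAlg R.

Definition alg_frac : freeAlg {fraction R} := bchange (@tofrac R) A.
Definition alg_fiber : freeAlg (kappa p) := bchange (kappa_map p) A.
Definition alg_dvr : freeAlg (valring O) := bchange dvr_map A.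
(* A^O/mA^O, identified with (O/m) (x)_R A. *)
Definition alg_residue : freeAlg (residue_field O) := bchange dvr_residue A.

Definition fiber_ext : {additive G0 alg_fiber -> G0 alg_residue} :=
  G0_ext kappa_residueE A.

End Gates.

Record perfect_gate (R : idomainType) (p : prime_idealr R) (A : freeAlg R) :=
  PerfectGate {
    gate_dvr :> dominating_dvr p;
    gate_perfect : bijective (fiber_ext gate_dvr A)
  }.

Section Decomposition.
Variables (R : idomainType) (p : prime_idealr R) (A : freeAlg R).
Variable O : perfect_gate p A.

(* The A^O-submodule of V spanned over O by the columns of U is an A^O-lattice:
   the columns are linearly independent over O, they span V over K, and A^O acts
   on them through the matrices of L. *)
Definition is_lattice (V : module (alg_frac A)) (L : module (alg_dvr O A))
    (U : 'M[{fraction R}]_(mdim V, mdim L)) : Prop :=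
  [/\ forall c : 'cV[valring O]_(mdim L),
        U *m map_mx (valring_map O) c = 0 -> c = 0,
      forall v : 'cV_(mdim V), exists c : 'cV_(mdim L), v = U *m c &
      forall x : alg_dvr O A,
        mact V (map_mx (valring_map O) x : alg_frac A) *m U =
        U *m map_mx (valring_map O) (mact L x)].

Definition lattice_red (L : module (alg_dvr O A)) : module (alg_residue O A) :=
  mod_tower (fun r => erefl (dvr_residue O r)) L.

(* [fiber_ext] is bijective for a perfect gate, so this determines d [V] as the
   inverse image of the class of the reduction of any lattice in V. *)
Definition is_decomposition_map
    (d : G0 (alg_frac A) -> G0 (alg_fiber p A)) : Prop :=
  forall (V : module (alg_frac A)) (L : module (alg_dvr O A)) U,
    @is_lattice V L U -> fiber_ext O A (d (G0cl V)) = G0cl (lattice_red L).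

End Decomposition.

Definition is_adjoint (F k : fieldType) (B : freeAlg F) (C : freeAlg k)
    (d : G0 B -> G0 C) (e : K0 C -> K0 B) : Prop :=
  forall (P : projmod C) (V : module B),
    intertwining (e (K0cl P)) (G0cl V) = intertwining (K0cl P) (d (G0cl V)).

Definition nonzero_ideal (R : idomainType) (p : prime_idealr R) : Prop :=
  exists2 r : R, r \in p & r != 0.

Definition normal_domain (R : idomainType) : Prop :=
  forall x : {fraction R}, integralOver (@tofrac R) x ->
    exists r : R, x = tofrac r.

(* Main.v *)
Require Import Defs.
From HB Require Import structures.
From mathcomp Require Import all_boot all_order all_algebra fieldext.
From mathcomp Require Import boolp freeg.
Set Implicit Arguments.
Unset Strict Implicit.
Unset Printing Implicit Defensive.
Import Order.TTheory GRing.Theory Num.Theory.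
Local Open Scope ring_scope.

(* Existence and uniqueness of the adjoint only use A^K: by splitness every
   additive function on G_0(A^K) is <y, -> for a unique y in K_0(A^K), because a
   simple module S has a projective cover P_S with <[P_S], [T]> = 1 if T is
   isomorphic to S and 0 for the other simple T.

   The formula for the Cartan map does not need idempotents to be lifted to a
   completion.  The bimodule A^K has a filtration with factors T_i (x) S_i^*,
   whence c(y) = sum_i <y, [S_i]> [T_i] on K_0(A^K), and it remains to see that
   dim f A(p) e = sum_i <[A(p) f], d [T_i]> <[A(p) e], d [S_i]> for idempotents
   e, f of A(p).  Lift e and f to elements of the lattice A^O.  The polynomial
   det (1 + X M), where M is x |-> f x e on A^K, is the product of its analogues
   on the T_i (x) S_i^*; it has coefficients in O, and modulo m each factor
   becomes a power of 1 + X whose exponent is the rank of an idempotent.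

   If R is normal, det (1 + X a) on V has coefficients in R for every a in A, so
   the exponents <[A(p) e], d [V]> obtained by reduction do not depend on O. *)

(** * Matrices *)

(** Traces of the operators x |-> f x e would give the multiplicities only modulo the characteristic
    of the residue field. The degree of a power of 1 + X gives them as integers, whence the
    determinants of 1 + X M. Since O need not be complete, an idempotent over k(m) need not lift to
    an idempotent of A^O; its lifts are mere elements, and powers of 1 + X appear only after
    reduction. The factorisation is proved over K by triangularity and then descends to O: each T_i
    and S_i receives a lattice of its own, chosen without reference to A^O, so every factor has
    coefficients in O, and O -> K is injective. Projectives are handled as B e, for which <[B e],
    [V]> is the rank of e on V. Ranks are unchanged along k(p) -> k(m), so pairings with d [V] are
    computed over k(m) without inverting the scalar extension on G_0. Splitness enters through the
    scalar endomorphisms of simple modules: they make Hom(P_S, S) one-dimensional, and they make the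
    evaluation of a bimodule M in T (x) Hom(M, T)^* surjective. *)

Lemma det1_mulC (S : comNzRingType) m n (A : 'M[S]_(m, n)) (B : 'M[S]_(n, m)) :
  \det (1%:M + A *m B) = \det (1%:M + B *m A).
Proof.
pose M := block_mx 1%:M (- A) B 1%:M : 'M[S]_(m + n).
have M1 : M *m block_mx 1%:M A 0 1%:M = block_mx 1%:M 0 B (1%:M + B *m A).
  rewrite mulmx_block !mulmx1 !mul1mx !mulmx0 !addr0 addrN.
  by rewrite (addrC (B *m A)).
have M2 : block_mx 1%:M A 0 1%:M *m M = block_mx (1%:M + A *m B) 0 B 1%:M.
  by rewrite mulmx_block !mulmx1 !mul1mx !mul0mx !add0r addNr.
have := congr1 determinant M1; have := congr1 determinant M2.
by rewrite !det_mulmx !det_lblock !det_ublock !det1 !mulr1 !mul1r => <- ->.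
Qed.

Section ReverseCharacteristicPolynomial.
Variable S : comNzRingType.

(* The characteristic polynomial read backwards: unlike [char_poly] it is not
   changed by zero eigenvalues, so that AB and BA have the same one. *)
Definition rchar n (M : 'M[S]_n) : {poly S} :=
  \det (1%:M + 'X *: map_mx polyC M).

Lemma rchar_mulC m n (A : 'M[S]_(m, n)) (B : 'M[S]_(n, m)) :
  rchar (A *m B) = rchar (B *m A).
Proof.
by rewrite /rchar !map_mxM scalemxAl det1_mulC -scalemxAr.
Qed.

(** Exchanging X and N leaves a scalar matrix of size d: the rank of an idempotent becomes an
    exponent. The factor [s] serves idempotents whose denominators have been cleared. *)
Lemma rchar_idem n d (s : S) (X : 'M[S]_(n, d)) (N : 'M[S]_(d, n)) :
  N *m X = 1%:M -> rchar (s *: (X *m N)) = (1 + s *: 'X) ^+ d.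
Proof.
move=> NX; rewrite scalemxAl rchar_mulC -scalemxAr NX /rchar map_mxZ map_mx1.
rewrite scalerA -[X in X + _]scale1r -scalerDl scalemx1 det_scalar.
by rewrite /= -commr_polyX mul_polyC.
Qed.

(** The last hypothesis says that the image of X is stable under M. The column of N, Y and the row
    of X, T are mutually inverse, but n and p + q are not convertible; [rchar_mulC] for rectangular
    factors replaces conjugation. *)
Lemma rchar_split n p q (X : 'M[S]_(n, p)) N (Y : 'M[S]_(q, n)) T M :
    X *m N + T *m Y = 1%:M -> Y *m X = 0 -> N *m X = 1%:M -> Y *m T = 1%:M ->
    Y *m (M *m X) = 0 ->
  rchar M = rchar (N *m M *m X) * rchar (Y *m M *m T).
Proof.
move=> XN YX NX YT YMX.
have -> : rchar M = rchar (col_mx N Y *m (M *m row_mx X T)).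
  by rewrite rchar_mulC -mulmxA mul_row_col XN mulmx1.
rewrite mul_mx_row mul_col_mx !mul_mx_row YMX /rchar map_col_mx !map_row_mx map_mx0.
rewrite scale_col_mx !scale_row_mx scaler0 scalar_mx_block.
rewrite -[col_mx _ _]/(block_mx _ _ _ _) add_block_mx !add0r.
by rewrite det_ublock !mulmxA.
Qed.

Lemma horner_rchar n (M : 'M[S]_n) x : (rchar M).[x] = \det (1%:M + x *: M).
Proof.
rewrite -[LHS]/(horner_eval x (rchar M)) /rchar -det_map_mx; congr determinant.
apply/matrixP => i j; rewrite !mxE -[LHS]/(((i == j)%:R + 'X * (M i j)%:P).[x]).
by rewrite hornerD hornerM hornerX hornerMn !hornerC.
Qed.

End ReverseCharacteristicPolynomial.

Lemma rchar_map (S S' : comNzRingType) (f : {rmorphism S -> S'}) n (M : 'M[S]_n) :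
  map_poly f (rchar M) = rchar (map_mx f M).
Proof.
rewrite /rchar -det_map_mx map_mxD map_mxZ map_mx1 /= map_polyX.
congr (\det (_ + _ *: _)); rewrite -!map_mx_comp; apply: eq_map_mx => x /=.
exact: map_polyC.
Qed.

Lemma idem_poly_inj (F : fieldType) (s : F) : s != 0 ->
  injective (fun d => (1 + s *: 'X : {poly F}) ^+ d).
Proof.
move=> s0 d e /(congr1 (fun p : {poly F} => (size p).-1)).
have sz : size (1 + s *: 'X : {poly F}) = 2%N.
  by rewrite addrC size_polyDl size_scale ?size_polyX // size_poly1.
by rewrite !size_exp sz !mul1n.
Qed.

Section Sandwich.
Variable S : comNzRingType.

(* The matrix, on column vectors, of the map x |-> A x B. *)
Definition sandmx m m' n n' (A : 'M[S]_(m, m')) (B : 'M[S]_(n', n)) :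
    'M[S]_(m * n, m' * n') :=
  (lin_mulmx A *m lin_mulmxr B)^T.

Lemma sandmxE m m' n n' (A : 'M[S]_(m, m')) (B : 'M[S]_(n', n)) x :
  sandmx A B *m (mxvec x)^T = (mxvec (A *m x *m B))^T.
Proof. by rewrite -trmx_mul mulmxA !mul_vec_lin. Qed.

Lemma mxvec_colP m n p (M N : 'M[S]_(m, n * p)) :
  (forall x : 'M_(n, p), M *m (mxvec x)^T = N *m (mxvec x)^T) -> M = N.
Proof.
move=> MN; apply: eq_colP => j; rewrite !colE.
have -> : delta_mx j 0 = (mxvec (vec_mx (delta_mx 0 j)))^T :> 'M[S]_(_, 1).
  by rewrite vec_mxK trmx_delta.
exact: MN.
Qed.

Lemma sandmxM m m' m'' n n' n'' (A : 'M[S]_(m, m')) (A' : 'M[S]_(m', m''))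
    (B : 'M[S]_(n', n)) (B' : 'M[S]_(n'', n')) :
  sandmx A B *m sandmx A' B' = sandmx (A *m A') (B' *m B).
Proof. by apply: mxvec_colP => x; rewrite -mulmxA !sandmxE !mulmxA. Qed.

Lemma sandmx1 m n : sandmx (1%:M : 'M[S]_m) (1%:M : 'M[S]_n) = 1%:M.
Proof. by apply: mxvec_colP => x; rewrite sandmxE !mul1mx mulmx1. Qed.

Lemma rchar_sandmx_idem m n p q (X : 'M[S]_(m, p)) N (Y : 'M[S]_(n, q)) M :
  N *m X = 1%:M -> M *m Y = 1%:M ->
  rchar (sandmx (X *m N) (Y *m M)) = (1 + 'X) ^+ (p * q).
Proof.
move=> NX MY; rewrite -sandmxM -[sandmx X M *m _]scale1r rchar_idem ?scale1r //.
by rewrite sandmxM NX MY sandmx1.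
Qed.

End Sandwich.

Lemma map_sandmx (S S' : comNzRingType) (f : {rmorphism S -> S'}) m m' n n'
    (A : 'M[S]_(m, m')) (B : 'M[S]_(n', n)) :
  map_mx f (sandmx A B) = sandmx (map_mx f A) (map_mx f B).
Proof.
rewrite /sandmx -map_trmx map_mxM; congr (_ *m _)^T;
  by apply: map_lin_mx => x; rewrite map_mxM.
Qed.

Section FieldMatrices.
Variable F : fieldType.

(** In a rank factorisation E = X N the equation X N X N = X N can be cancelled by X on the left and
    by N on the right. *)
Lemma idem_base n (E : 'M[F]_n) : E *m E = E -> row_base E *m col_base E = 1%:M.
Proof.
move=> EE; have [C CK] := row_freeP (row_base_free E).
have [D DK] := row_fullP (col_base_full E).
move: (col_base E) (row_base E) (mulmx_base E) CK DK => X N XN CK DK.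
move: EE; rewrite -{1 2 3}XN => /(congr1 (fun M => D *m M *m C)).
by rewrite !mulmxA DK !mul1mx -!mulmxA CK !mulmx1.
Qed.

(** For a rank factorisation h = X Y, the hypothesis forces Y X to be invertible. This is G, the
    restriction of h to its image, and X N is the projection onto the image along the kernel. *)
Lemma fitting n (h : 'M[F]_n) : (\rank h <= \rank (h *m h))%N ->
  exists r (X : 'M[F]_(n, r)) N G,
    [/\ r = \rank h, h = X *m G *m N, N *m X = 1%:M & G \in unitmx].
Proof.
move: (col_base h) (row_base h) (mulmx_base h) => X Y XY hh.
have Gu : Y *m X \in unitmx.
  rewrite -row_free_unit -row_leq_rank; apply: leq_trans hh _.
  rewrite -{1 2}XY mulmxA -(mulmxA X) -mulmxA.
  exact: leq_trans (mxrankM_maxr _ _) (mxrankM_maxl _ _).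
exists (\rank h), X, (invmx (Y *m X) *m Y), (Y *m X); split=> //.
  by rewrite [RHS]mulmxA mulmxK // XY.
by rewrite -mulmxA mulVmx.
Qed.

Lemma split_of_linv n p (X : 'M[F]_(n, p)) N : N *m X = 1%:M ->
  exists q (Y : 'M[F]_(q, n)) T,
    [/\ q = (n - p)%N, Y *m X = 0, Y *m T = 1%:M & X *m N + T *m Y = 1%:M].
Proof.
move=> NX; pose Y := row_base (kermx X).
have rX : \rank X = p by apply/eqP/row_fullP; exists N.
have YX : Y *m X = 0.
  by apply/sub_kermxP; rewrite eq_row_base.
have [Z YZ] := row_freeP (row_base_free (kermx X)).
have /submxP [T TE] : ((1%:M - X *m N)%R <= Y)%MS.
  rewrite eq_row_base; apply/sub_kermxP.
  by rewrite mulmxBl mul1mx -mulmxA NX mulmx1 subrr.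
exists (\rank (kermx X)), Y, T; split=> //.
- by rewrite mxrank_ker rX.
- have : Y *m (1%:M - X *m N) = Y.
    by rewrite mulmxBr mulmx1 mulmxA YX mul0mx subr0.
  by rewrite TE mulmxA => /(congr1 (mulmxr Z)) /=; rewrite -mulmxA YZ mulmx1.
by rewrite -TE addrC subrK.
Qed.

Lemma split_of_rinv n q (Y : 'M[F]_(q, n)) T : Y *m T = 1%:M ->
  exists p (X : 'M[F]_(n, p)) N,
    [/\ p = (n - q)%N, Y *m X = 0, N *m X = 1%:M & X *m N + T *m Y = 1%:M].
Proof.
move=> YT; have : T^T *m Y^T = 1%:M by rewrite -trmx_mul YT trmx1.
move=> /split_of_linv[p [X [N [pE XY XN YX]]]]; exists p, X^T, N^T; split=> //.
- by rewrite -[Y]trmxK -trmx_mul XY trmx0.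
- by rewrite -trmx_mul XN trmx1.
by move/(congr1 trmx): YX; rewrite linearD /= !trmx_mul !trmxK trmx1 addrC.
Qed.

(** Passes from subspaces, suited to maximality arguments, to split injections given by matrices. *)
Lemma vspace_cols n (U : {vspace 'cV[F]_n}) :
  exists (X : 'M[F]_(n, \dim U)) N,
    N *m X = 1%:M /\ forall v : 'cV_n, v \in U <-> exists u, v = X *m u.
Proof.
pose X : 'M[F]_(n, \dim U) := \matrix_(i, j) (vbasis U)`_j i 0.
have Xu u : X *m u = \sum_j u j 0 *: (vbasis U)`_j.
  apply/colP => i; rewrite !mxE summxE; apply: eq_bigr => j _.
  by rewrite !mxE mulrC.
have XU v : v \in U <-> exists u, v = X *m u.
  split=> [/coord_vbasis -> |[u ->]]; last first.
    by rewrite Xu; apply: memv_suml => j _; rewrite memvZ // vbasis_mem // mem_nth ?size_tuple.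
  exists (\col_j coord (vbasis U) j v); rewrite Xu.
  by apply: eq_bigr => j _; rewrite mxE.
have Xfree : row_free X^T.
  apply/row_freeP; exists (pinvmx X^T); apply: mulmxVp.
  rewrite -kermx_eq0; apply/eqP/row_matrixP => i; rewrite row0.
  set w := row i _; have wX : w *m X^T = 0.
    by apply/sub_kermxP; rewrite row_sub.
  have := congr1 trmx wX; rewrite trmx_mul trmxK Xu trmx0.
  have /freeP/(_ (fun j => w^T j 0)) fr := basis_free (vbasisP U).
  by move/fr => w0; apply/rowP => j; have := w0 j; rewrite !mxE.
have [N XN] := row_freeP Xfree; exists X, N^T; split=> //.
by rewrite -[X]trmxK -trmx_mul XN trmx1.
Qed.

End FieldMatrices.

(** * Roots in field extensions *)

Lemma root_extension (F : fieldType) (p : {poly F}) : (1 < size p)%N ->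
  exists (L : fieldType) (iota : {rmorphism F -> L}) (z : L),
    root (map_poly iota p) z.
Proof.
move=> p1; pose P n := `[< exists2 q, q %| p & (1 < size q)%N && (size q == n) >].
have exP : exists n, P n by exists (size p); apply/asboolP; exists p; rewrite ?dvdpp ?p1 /=.
case: (ex_minnP exP) => n /asboolP[q qp /andP[q1 /eqP qn]] nmin.
have irr : irreducible_poly q.
  split=> // d d1 dq; rewrite -dvdp_size_eqp // eqn_leq dvdp_leq //; last first.
    by rewrite -size_poly_gt0 ltnW.
  rewrite qn nmin //; apply/asboolP; exists d; first exact: dvdp_trans qp.
  rewrite eqxx andbT ltn_neqAle eq_sym d1 size_poly_gt0.
  by apply: contraTneq dq => ->; rewrite dvd0p -size_poly_gt0 ltnW.
have [L _ [z qz _]] := irredp_FAdjoin irr.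
exists L, (in_alg L), z; move: qz; rewrite -!dvdp_XsubCl => /dvdp_trans; apply.
by rewrite dvdp_map.
Qed.

Lemma splitting_field (F : fieldType) (p : {poly F}) :
  exists (L : fieldType) (iota : {rmorphism F -> L}) (rs : seq L),
    map_poly iota p = lead_coef (map_poly iota p) *: \prod_(z <- rs) ('X - z%:P).
Proof.
have [n] := ubnP (size p); elim: n F p => // n IHn F p pn.
have [p1|p1] := leqP (size p) 1.
  exists F, idfun, [::]; rewrite big_nil map_poly_id // (size1_polyC p1).
  by rewrite lead_coefC alg_polyC.
have [L1 [iota1 [z pz]]] := root_extension p1.
have [q pq] := factor_theorem _ _ pz.
have q0 : q != 0.
  apply: contraTneq p1 => q0; move: pq; rewrite q0 mul0r => /eqP.
  by rewrite map_poly_eq0 => /eqP ->; rewrite size_poly0.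
have qn : (size q < n)%N.
  rewrite -ltnS; apply: leq_trans pn; rewrite ltnS -(size_map_poly iota1) pq.
  by rewrite size_Mmonic ?monicXsubC // size_XsubC addn2.
have [L [iota [rs qrs]]] := IHn L1 q qn.
exists L, (iota \o iota1), (iota z :: rs).
rewrite map_poly_comp pq rmorphM /= map_polyXsubC big_cons.
by rewrite lead_coef_Mmonic ?monicXsubC // mulrC {1}qrs -scalerAr.
Qed.

(** * Modules *)

Section RegularModule.
Variables (S : comNzRingType) (B : freeAlg S).
Implicit Types (a b : B) (V W : module B).

(** Module elements are columns, whereas [acoord] yields rows. *)
Definition acol a : 'cV[S]_(arank B) := (acoord a)^T.

Lemma acol_lin s a b : acol (ascal B s * a + b) = s *: acol a + acol b.
Proof. by rewrite /acol acoord_lin linearD linearZ. Qed.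

Lemma acolE a i : acol a i 0 = acoord a 0 i.
Proof. by rewrite mxE. Qed.

Lemma acol_surj v : exists a, acol a = v.
Proof.
have [g gK Kg] := acoord_bij B; exists (g v^T).
by rewrite /acol Kg trmxK.
Qed.

Lemma acol_inj : injective acol.
Proof. by move=> a b /trmx_inj; apply: (bij_inj (acoord_bij B)). Qed.

Lemma mulmx_acolP m (M N : 'M[S]_(m, arank B)) :
  (forall a, M *m acol a = N *m acol a) -> M = N.
Proof.
move=> MN; apply: eq_colP => j; rewrite !colE.
by have [a <-] := acol_surj (delta_mx j 0).
Qed.

Definition acol_mx m (g : B -> 'cV[S]_m) : 'M[S]_(m, arank B) :=
  \matrix_(i, j) g (abasis j) i 0.

Lemma acol_mxE m (g : B -> 'cV[S]_m) :
    (forall s a b, g (ascal B s * a + b) = s *: g a + g b) ->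
  forall a, acol_mx g *m acol a = g a.
Proof.
move=> g_lin a.
have gD b c : g (b + c) = g b + g c.
  by have := g_lin 1 b c; rewrite rmorph1 mul1r scale1r.
have g0 : g 0 = 0 by apply: (@addIr _ (g 0)); rewrite -gD !add0r.
have gZ s b : g (ascal B s * b) = s *: g b by rewrite -[X in g X]addr0 g_lin g0 addr0.
rewrite {2}(abasis_sum a) (big_morph g gD g0); apply/colP => i.
rewrite !mxE summxE; apply: eq_bigr => j _.
by rewrite gZ !mxE mulrC.
Qed.

Definition regmx a := acol_mx (fun b => acol (a * b)).
Definition rmulmx a := acol_mx (fun b => acol (b * a)).

Lemma regmxE a b : regmx a *m acol b = acol (a * b).
Proof.
apply: (acol_mxE (g := fun b => acol (a * b))) => s c d.
by rewrite mulrDr mulrA -ascalC -mulrA acol_lin.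
Qed.

Lemma rmulmxE a b : rmulmx a *m acol b = acol (b * a).
Proof.
apply: (acol_mxE (g := fun b => acol (b * a))) => s c d.
by rewrite mulrDl -mulrA acol_lin.
Qed.

Lemma regmx_lin s a b : regmx (ascal B s * a + b) = s *: regmx a + regmx b.
Proof.
apply: mulmx_acolP => c.
by rewrite mulmxDl -scalemxAl !regmxE mulrDl -mulrA acol_lin.
Qed.

Lemma regmx1 : regmx 1 = 1%:M.
Proof. by apply: mulmx_acolP => c; rewrite regmxE !mul1r mul1mx. Qed.

Lemma regmxM a b : regmx (a * b) = regmx a *m regmx b.
Proof. by apply: mulmx_acolP => c; rewrite -mulmxA !regmxE mulrA. Qed.

Definition regmod : module B := Module regmx_lin regmx1 regmxM.

Lemma rmulmx_lin s a b : rmulmx (ascal B s * a + b) = s *: rmulmx a + rmulmx b.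
Proof.
apply: mulmx_acolP => c.
by rewrite mulmxDl -scalemxAl !rmulmxE mulrDr mulrA -ascalC -mulrA acol_lin.
Qed.

Lemma rmulmx1 : rmulmx 1 = 1%:M.
Proof. by apply: mulmx_acolP => c; rewrite rmulmxE !mulr1 mul1mx. Qed.

Lemma rmulmxM a b : rmulmx (a * b) = rmulmx b *m rmulmx a.
Proof. by apply: mulmx_acolP => c; rewrite -mulmxA !rmulmxE mulrA. Qed.

Lemma rmulmx_hom a : @mod_hom _ _ regmod regmod (rmulmx a).
Proof.
by move=> b; apply: mulmx_acolP => c; rewrite /= -!mulmxA !(regmxE, rmulmxE) mulrA.
Qed.

Definition orbmx W (w : 'cV[S]_(mdim W)) := acol_mx (fun a => mact W a *m w).

Lemma orbmxE W w a : @orbmx W w *m acol a = mact W a *m w.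
Proof.
apply: (acol_mxE (g := fun a => mact W a *m w)) => s b c.
by rewrite mact_lin mulmxDl scalemxAl.
Qed.

Lemma orbmx_hom W w : @mod_hom _ _ regmod W (orbmx w).
Proof.
move=> b; apply: mulmx_acolP => c.
by rewrite /= -!mulmxA regmxE !orbmxE mactM mulmxA.
Qed.

Lemma hom_regmod W X : @mod_hom _ _ regmod W X -> X = orbmx (X *m acol 1).
Proof.
move=> hX; apply: mulmx_acolP => a; rewrite orbmxE mulmxA hX -mulmxA.
by rewrite regmxE mulr1.
Qed.

Lemma hom_regmod_rmulmx X : @mod_hom _ _ regmod regmod X ->
  exists a, X = rmulmx a.
Proof.
move=> hX; have [a aE] := acol_surj (X *m acol 1); exists a.
rewrite (hom_regmod hX); apply: mulmx_acolP => b.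
by rewrite orbmxE -aE regmxE rmulmxE.
Qed.

Lemma regmod_projective : mod_projective regmod.
Proof.
move=> M N f g hf hg fsurj; have [v vE] := fsurj (g *m acol 1).
exists (orbmx v); first exact: orbmx_hom.
apply: mulmx_acolP => a; rewrite -mulmxA orbmxE mulmxA -hf -mulmxA -vE.
by rewrite mulmxA hg -mulmxA regmxE mulr1.
Qed.

End RegularModule.

(** * Submodules and quotients in coordinates *)

Section Compression.
Variables (S : comNzRingType) (B : freeAlg S) (V : module B) (p : nat).
Variables (X : 'M[S]_(mdim V, p)) (N : 'M[S]_(p, mdim V)).
Hypothesis NX : N *m X = 1%:M.

(** One formula serves both cases: it is multiplicative if the image of X is stable, and also if the
    kernel of N is stable. *)
Let act (b : B) := N *m mact V b *m X.

Let act_lin s (a b : B) : act (ascal B s * a + b) = s *: act a + act b.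
Proof. by rewrite /act mact_lin mulmxDr mulmxDl -scalemxAr -scalemxAl. Qed.

Let act1 : act 1 = 1%:M.
Proof. by rewrite /act mact1 mulmx1. Qed.

Section Sub.
Hypothesis stab : forall b, mact V b *m X = X *m (N *m mact V b *m X).

Let actM a b : act (a * b) = act a *m act b.
Proof. by rewrite /act mactM -!mulmxA [in LHS]stab !mulmxA. Qed.

Definition submod : module B := Module act_lin act1 actM.

Lemma submod_hom : @mod_hom _ _ submod V X.
Proof. exact: stab. Qed.
End Sub.

Section Quot.
Hypothesis stab : forall b, N *m mact V b = N *m mact V b *m X *m N.

Let actM a b : act (a * b) = act a *m act b.
Proof. by rewrite /act mactM !mulmxA [in LHS]stab. Qed.

Definition quotmod : module B := Module act_lin act1 actM.
End Quot.

End Compression.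

Lemma summand_projective (S : comNzRingType) (B : freeAlg S) (V P : module B) X N :
    @mod_hom _ _ P V X -> @mod_hom _ _ V P N -> N *m X = 1%:M ->
  mod_projective V -> mod_projective P.
Proof.
move=> hX hN NX projV M M' f g hf hg fsurj.
have [h hh fh] := projV _ _ f (g *m N) hf (mod_hom_comp hg hN) fsurj.
exists (h *m X); first exact: mod_hom_comp.
by rewrite mulmxA fh -mulmxA NX mulmx1.
Qed.

Section BaseChangeRegular.
Variables (R S S' : comNzRingType) (phi : {rmorphism R -> S}).
Variables (phi' : {rmorphism R -> S'}) (psi : {rmorphism S -> S'}).
Hypothesis psi_phi : forall r, psi (phi r) = phi' r.
Variable A : freeAlg R.

Definition bcmap (x : bchange phi A) : bchange phi' A := map_mx psi x.

Lemma bcmap_bcin a : bcmap (bcin phi a) = bcin phi' a.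
Proof. by apply/rowP => i; rewrite !mxE. Qed.

Lemma bcmapM (x y : bchange phi A) : bcmap (x * y) = bcmap x * bcmap y.
Proof.
rewrite /bcmap [in LHS]/GRing.mul [in RHS]/GRing.mul /= /bcmul.
rewrite raddf_sum; apply: eq_bigr => i _ /=.
rewrite raddf_sum; apply: eq_bigr => j _ /=.
rewrite /bcscale map_mxZ /= rmorphM /= !mxE; congr (_ *: _).
exact: bcmap_bcin.
Qed.

Lemma bc_abasis i : @abasis _ (bchange phi A) i = bcin phi (@abasis _ A i).
Proof. by rewrite bcin_basis -(@acoord_basis _ (bchange phi A) i). Qed.

Lemma bcmap_abasis i :
  bcmap (@abasis _ (bchange phi A) i) = @abasis _ (bchange phi' A) i.
Proof. rewrite bc_abasis bcmap_bcin bcin_basis.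
by rewrite -(@acoord_basis _ (bchange phi' A) i). Qed.

(** The basis of A yields the bases of both scalar extensions, so one matrix over O governs
    multiplication on A^K and its reduction modulo m. *)
Lemma regmx_bcmap x : map_mx psi (regmx x) = regmx (bcmap x).
Proof.
apply/matrixP => i j; rewrite !mxE.
by rewrite -bcmap_abasis -bcmapM mxE.
Qed.

Lemma rmulmx_bcmap x : map_mx psi (rmulmx x) = rmulmx (bcmap x).
Proof.
apply/matrixP => i j; rewrite !mxE.
by rewrite -bcmap_abasis -bcmapM mxE.
Qed.

Lemma mact_mod_tower W x :
  mact (mod_tower psi_phi W) (bcmap x : bchange phi' A) = map_mx psi (mact W x).
Proof.
rewrite (mactE W) raddf_sum; apply: eq_bigr => i _ /=.
by rewrite map_mxZ mxE bc_abasis.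
Qed.

End BaseChangeRegular.

Lemma inv_hom (S : comNzRingType) (B : freeAlg S) (V W : module B) X Y :
    @mod_hom _ _ V W X -> Y *m X = 1%:M -> X *m Y = 1%:M ->
  @mod_hom _ _ W V Y.
Proof.
move=> hX YX XY b; rewrite -[LHS]mul1mx -YX -mulmxA (mulmxA X) -hX.
by rewrite -!mulmxA XY mulmx1.
Qed.

Lemma mod_hom0 (S : comNzRingType) (B : freeAlg S) (V W : module B) :
  @mod_hom _ _ V W 0.
Proof. by move=> b; rewrite mulmx0 mul0mx. Qed.

Lemma neq0_colP (S : comNzRingType) m n (X : 'M[S]_(m, n)) :
  X <> 0 -> exists v : 'cV_n, X *m v <> 0.
Proof.
move=> X0; apply: contrapT => nv; apply: X0; apply: eq_colP => j.
by rewrite linear0 colE; apply: contrapT => h; apply: nv; exists (delta_mx j 0).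
Qed.

Definition mod_iso (S : comNzRingType) (B : freeAlg S) (V W : module B) : Prop :=
  exists f g, [/\ @mod_hom _ _ V W f, @mod_hom _ _ W V g,
                  g *m f = 1%:M & f *m g = 1%:M].

(** * Simple modules *)

Section SimpleModules.
Variables (F : fieldType) (B : freeAlg F).
Implicit Types (V W P : module B).

Lemma simple_cyclic (T : module B) (w t : 'cV_(mdim T)) : mod_simple T -> w <> 0 ->
  exists b, mact T b *m w = t.
Proof.
move=> [_ /(_ (limg (linfun (mulmx (orbmx w)))))] T_irr w0.
have [|U0|U1] := T_irr.
- move=> b v /memv_imgP[u _ ->]; apply/memv_imgP; exists (regmx b *m u) => //.
    exact: memvf.
  by rewrite !lfunE /= !mulmxA (orbmx_hom w b).
- case: w0; apply/eqP; rewrite -memv0 -U0; apply/memv_imgP; exists (acol 1).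
    exact: memvf.
  by rewrite lfunE /= orbmxE mact1 mul1mx.
have : t \in limg (linfun (mulmx (orbmx w))) by rewrite U1 memvf.
case/memv_imgP => v _; rewrite lfunE /= => ->; have [a <-] := acol_surj v.
by exists a; rewrite orbmxE.
Qed.

(** A non-zero morphism to a simple module is onto. The right inverse is linear only, not a morphism
    of modules. *)
Lemma hom_to_simple V T X : @mod_hom _ _ V T X -> mod_simple T -> X <> 0 ->
  exists Y, X *m Y = 1%:M.
Proof.
move=> hX simT /neq0_colP[v Xv].
have [j|Y YE] := @col_solve _ _ _ _ X (1%:M); last by exists Y.
have [b bE] := simple_cyclic (col j 1%:M) simT Xv.
by exists (mact V b *m v); rewrite -bE !mulmxA hX.
Qed.

Lemma ker_exact V W Y T : @mod_hom _ _ V W Y -> Y *m T = 1%:M ->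
  exists (V' : module B) (X : 'M_(mdim V, mdim V')) N,
    [/\ mdim V' = (mdim V - mdim W)%N, mod_hom X, N *m X = 1%:M,
        Y *m X = 0 & X *m N + T *m Y = 1%:M].
Proof.
move=> hY YT; have [p [X [N [pE YX NX XN]]]] := split_of_rinv YT.
have stab b : mact V b *m X = X *m (N *m mact V b *m X).
  rewrite !mulmxA -[LHS]mul1mx -XN mulmxDl -(mulmxA T) (mulmxA Y) -hY.
  by rewrite -!mulmxA YX !mulmx0 addr0.
by exists (submod NX stab), X, N.
Qed.

Lemma ker_short_exact V W V' Y T (X : 'M_(mdim V, mdim V')) N :
    @mod_hom _ _ V W Y -> mod_hom X -> Y *m T = 1%:M -> N *m X = 1%:M ->
    Y *m X = 0 -> X *m N + T *m Y = 1%:M ->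
  short_exact V V' W.
Proof.
move=> hY hX YT NX YX XN.
by have [? ? ?] := split_exact YX YT NX XN; exists X, Y.
Qed.

Lemma quot_exact V (U : {vspace 'cV_(mdim V)}) :
    (forall (b : B) v, v \in U -> mact V b *m v \in U) ->
  exists (W : module B) (Y : 'M_(mdim W, mdim V)) T,
    [/\ mdim W = (mdim V - \dim U)%N, mod_hom Y, Y *m T = 1%:M &
        forall v, v \in U <-> Y *m v = 0].
Proof.
move=> stabU; have [X [N [NX UE]]] := vspace_cols U.
have [q [Y [T [qE YX YT XN]]]] := split_of_linv NX.
have Ub b : exists K, mact V b *m X = X *m K.
  apply: col_solve => j; apply/UE; rewrite col_mul; apply: stabU; apply/UE.
  by exists (delta_mx j 0); rewrite colE.
have stab b : Y *m mact V b = Y *m mact V b *m T *m Y.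
  rewrite -[LHS]mulmx1 -XN mulmxDr !mulmxA -[Y *m _ *m X]mulmxA.
  by have [K ->] := Ub b; rewrite mulmxA YX !mul0mx add0r.
exists (quotmod YT stab), Y, T; split=> //.
move=> v; split=> [/UE[u ->]|Yv]; first by rewrite mulmxA YX mul0mx.
apply/UE; exists (N *m v).
by rewrite -[LHS]mul1mx -XN mulmxDl -(mulmxA T) Yv mulmx0 addr0 mulmxA.
Qed.

(** The quotient is by a proper stable subspace U of maximal dimension: the preimage of a stable
    subspace of the quotient is U or everything. *)
Lemma simple_quotient V : (0 < mdim V)%N ->
  exists (T : module B) (Y : 'M_(mdim T, mdim V)) Z,
    [/\ mod_simple T, mod_hom Y & Y *m Z = 1%:M].
Proof.
move=> V0; pose stable (U : {vspace 'cV[F]_(mdim V)}) :=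
  forall (b : B) v, v \in U -> mact V b *m v \in U.
have dimV : \dim (fullv : {vspace 'cV[F]_(mdim V)}) = mdim V.
  by rewrite dimvf /dim /= muln1.
pose Q k := `[< exists U, [/\ stable U, (\dim U < mdim V)%N & \dim U = k] >].
have exQ : exists k, Q k.
  exists 0%N; apply/asboolP; exists 0%VS; split; rewrite ?dimv0 //.
  by move=> b v; rewrite !memv0 => /eqP ->; rewrite mulmx0.
have leQ k : Q k -> (k <= mdim V)%N.
  by move/asboolP => [U [_ ? <-]]; apply: ltnW.
case: (ex_maxnP exQ leQ) => k /asboolP[U [stabU ltU kE]] kmax.
have [T [Y [Z [mT hY YZ UE]]]] := quot_exact stabU.
exists T, Y, Z; split=> //; split; first by rewrite mT subn_gt0.
move=> U' stabU'; pose U1 := (linfun (mulmx Y) @^-1: U')%VS.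
have U1E v : (v \in U1) = (Y *m v \in U') by rewrite -memv_preim lfunE.
have stabU1 : stable U1.
  by move=> b v; rewrite !U1E mulmxA -hY -mulmxA; apply: stabU'.
have sUU1 : (U <= U1)%VS by apply/subvP => v /UE; rewrite U1E => ->; apply: mem0v.
have [ltU1|geU1] := ltnP (\dim U1) (mdim V).
  left; have : (\dim U1 <= k)%N by apply: kmax; apply/asboolP; exists U1.
  rewrite -kE => leU1; have UU1 : U = U1 by apply/eqP; rewrite eqEdim sUU1.
  apply/eqP; rewrite -subv0; apply/subvP => w wU'; rewrite memv0 -[w]mul1mx -YZ.
  rewrite -mulmxA; apply/eqP/UE; rewrite UU1 U1E mulmxA YZ mul1mx //.
right; have /eqP U1f : U1 == fullv by rewrite eqEdim subvf dimV.
apply/eqP; rewrite eqEsubv subvf; apply/subvP => w _.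
by rewrite -[w]mul1mx -YZ -mulmxA -U1E U1f memvf.
Qed.

Lemma schur (S T : module B) f : mod_simple S -> mod_simple T -> @mod_hom _ _ S T f ->
  f <> 0 -> mod_iso S T.
Proof.
move=> simS simT hf f0; have [g fg] := hom_to_simple hf simT f0.
have inj (u : 'cV_(mdim S)) : f *m u = 0 -> u = 0.
  move=> fu; apply: contrapT => u0; have [v fv] := neq0_colP f0.
  have [b bE] := simple_cyclic v simS u0; case: fv.
  by rewrite -bE mulmxA -hf -mulmxA fu mulmx0.
have gf : g *m f = 1%:M.
  apply: eq_colP => j; apply/eqP; rewrite -subr_eq0 -linearB; apply/eqP.
  by apply: inj; rewrite -col_mul mulmxBr mulmxA fg mul1mx mulmx1 subrr linear0.
by exists f, g; split=> //; apply: inv_hom hf _ _.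
Qed.

Lemma hom_dim_gt0 V W : (0 < hom_dim V W)%N <-> exists2 X, @mod_hom _ _ V W X & X <> 0.
Proof.
rewrite lt0n dimv_eq0 -vpick0; split=> [X0|[X hX X0]].
  exists (vpick (homv V W)); last exact/eqP.
  exact/homvP/memv_pick.
apply/eqP => XE; apply: X0; apply/eqP.
by have /homvP := hX; move/eqP: XE; rewrite vpick0 => /eqP ->; rewrite memv0.
Qed.

End SimpleModules.

(** * Projective modules generated by an idempotent *)

Section Corners.
Variables (F : fieldType) (B : freeAlg F).
Implicit Types (V W P : module B) (e f : B).

(** P is identified with B e, onto which right multiplication by e projects B. That e is idempotent
    follows. *)
Definition corner e P : Prop :=
  exists X N, [/\ @mod_hom _ _ P (regmod B) X, @mod_hom _ _ (regmod B) P N,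
                  N *m X = 1%:M & X *m N = rmulmx e].

Lemma rmulmx_inj : injective (@rmulmx F B).
Proof.
move=> a b ab; apply: acol_inj.
by rewrite -[a]mul1r -[b]mul1r -!rmulmxE ab.
Qed.

Lemma corner_idem e P : corner e P -> e * e = e.
Proof.
move=> [X [N [_ _ NX XN]]]; apply: rmulmx_inj.
by rewrite rmulmxM -XN mulmxA -(mulmxA X) NX mulmx1.
Qed.

Lemma corner_projective e P : corner e P -> mod_projective P.
Proof.
by move=> [X [N [hX hN NX _]]]; apply: summand_projective hX hN NX (@regmod_projective _ _).
Qed.

Lemma summand_corner P X N : @mod_hom _ _ P (regmod B) X ->
  @mod_hom _ _ (regmod B) P N -> N *m X = 1%:M -> exists e, corner e P.
Proof.
move=> hX hN NX; have [e eE] := hom_regmod_rmulmx (mod_hom_comp hX hN).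
by exists e, X, N.
Qed.

Lemma corner_exists e : e * e = e -> exists P, corner e P.
Proof.
move=> ee; have EE : rmulmx e *m rmulmx e = rmulmx e by rewrite -rmulmxM ee.
have := idem_base EE; move: (row_base _) (col_base _) (mulmx_base (rmulmx e)).
move=> N X XN NX.
have hE := @rmulmx_hom _ _ e; rewrite -XN in hE.
have stab b : mact (regmod B) b *m X = X *m (N *m mact (regmod B) b *m X).
  by rewrite !mulmxA -hE -mulmxA -(mulmxA X) NX mulmx1.
exists (@submod _ _ (regmod B) _ _ _ NX stab), X, N; split=> //.
move=> b; rewrite /= -!mulmxA.
by rewrite -[regmx b]/(mact (regmod B) b) hE !mulmxA NX mul1mx.
Qed.

(** Evaluation at e identifies Hom(B e, W) with e W. In the proof [c] is e seen in P, and [Ne] gives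
    coordinates on e W. *)
Lemma corner_hom_dim e P W : corner e P -> hom_dim P W = \rank (mact W e).
Proof.
move=> cP; have ee := corner_idem cP; have [X [N [hX hN NX XN]]] := cP.
have EE : mact W e *m mact W e = mact W e by rewrite -mactM ee.
suff main r (Xe : 'M_(mdim W, r)) (Ne : 'M_(r, mdim W)) :
    Xe *m Ne = mact W e -> Ne *m Xe = 1%:M -> hom_dim P W = r.
  exact: main (mulmx_base _) (idem_base EE).
move=> XNe NXe; pose c := N *m acol 1.
have Xc : X *m c = acol e by rewrite mulmxA XN rmulmxE mul1r.
have ec : mact P e *m c = c.
  by rewrite mulmxA hN -mulmxA regmxE mulr1 -Xc mulmxA NX mul1mx.
have ZE Z : mod_hom Z -> Z = orbmx (Z *m c) *m X.
  move=> hZ; rewrite {1}(_ : Z = Z *m N *m X); last by rewrite -mulmxA NX mulmx1.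
  by rewrite (hom_regmod (mod_hom_comp hZ hN)) -mulmxA.
pose L := (linfun (mulmx Ne) \o linfun (mulmxr c))%VF.
have LE Z : L Z = Ne *m (Z *m c) by rewrite lfunE /= !lfunE.
have dimr : \dim (fullv : {vspace 'cV[F]_r}) = r.
  by rewrite dimvf /dim /= muln1.
rewrite -[RHS]dimr /hom_dim -(@limg_dim_eq _ _ _ L).
  congr (\dim _); apply/vspaceP => u; rewrite memvf; apply/memv_imgP.
  exists (orbmx (Xe *m u) *m X); last first.
    by rewrite LE -mulmxA Xc orbmxE -XNe !mulmxA NXe mul1mx NXe mul1mx.
  by apply/homvP; apply: mod_hom_comp hX; apply: orbmx_hom.
apply/eqP; rewrite -subv0; apply/subvP => Z; rewrite memv_cap memv_ker LE memv0.
move=> /andP[/homvP hZ /eqP NZ]; apply/eqP.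
have Zc : Z *m c = 0.
  by rewrite -ec mulmxA -hZ -mulmxA -XNe -mulmxA NZ mulmx0.
rewrite (ZE W Z hZ) Zc (_ : orbmx 0 = 0) ?mul0mx //.
by apply: mulmx_acolP => a; rewrite orbmxE mul0mx mulmx0.
Qed.

Lemma corner_rchar e P W s : corner e P ->
  rchar (s *: mact W e) = (1 + s *: 'X) ^+ (hom_dim P W).
Proof.
move=> cP; have ee := corner_idem cP; rewrite (corner_hom_dim _ cP).
have EE : mact W e *m mact W e = mact W e by rewrite -mactM ee.
by rewrite -{1}(mulmx_base (mact W e)) rchar_idem ?idem_base.
Qed.

(** On B the map x |-> f x e kills B (1 - e) and agrees with f on B e modulo nothing else; the zero
    eigenvalues leave [rchar] unchanged. *)
Lemma rchar_mact_corner e P f : corner e P ->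
  rchar (mact P f) = rchar (regmx f *m rmulmx e).
Proof.
move=> [X [N [hX hN NX XN]]]; rewrite -XN mulmxA [in RHS]rchar_mulC.
by rewrite mulmxA -hN -mulmxA NX mulmx1.
Qed.

End Corners.

(** * Projective covers and Grothendieck groups *)

Lemma groth_ind (T : choiceType) (E : T -> T -> T -> Prop)
    (Phi : groth E -> Prop) :
    Phi 0 -> (forall x y, Phi x -> Phi y -> Phi (x - y)) ->
    (forall V, Phi (gclass V)) ->
  forall x, Phi x.
Proof.
move=> Phi0 PhiB PhiV.
have PhiN x : Phi x -> Phi (- x) by move=> hx; rewrite -sub0r; apply: PhiB.
have PhiD x y : Phi x -> Phi y -> Phi (x + y).
  by move=> hx hy; rewrite -[y]opprK; apply/PhiB/PhiN.
have PhiM x (n : nat) : Phi x -> Phi (x *+ n).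
  by move=> hx; elim: n => [|n IHn]; rewrite ?mulr0n // mulrS; apply: PhiD.
have PhiZ x (n : int) : Phi x -> Phi (x *~ n).
  by case: n => n hx; [apply: PhiM | apply/PhiN/PhiM].
elim/quotW=> D; elim/freeg_ind_dom0: D => [|k V D _ _ IH]; first by rewrite raddf0.
rewrite raddfD; apply: PhiD => //.
rewrite -[k]intz -freegU_mulz raddfMz; apply/PhiZ/PhiV.
Qed.

Section ZeroModule.
Variables (S : comNzRingType) (B : freeAlg S).

Let zact (b : B) : 'M[S]_0 := 0.

Let zact_lin s (a b : B) : zact (ascal B s * a + b) = s *: zact a + zact b.
Proof. by rewrite [RHS]flatmx0 [LHS]flatmx0. Qed.

Let zact1 : zact 1 = 1%:M.
Proof. by rewrite [RHS]flatmx0 [LHS]flatmx0. Qed.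

Let zactM a b : zact (a * b) = zact a *m zact b.
Proof. by rewrite [RHS]flatmx0 [LHS]flatmx0. Qed.

Definition zeromod : module B := Module zact_lin zact1 zactM.

Lemma zeromod_projective : mod_projective zeromod.
Proof.
move=> M N f g _ _ _; exists 0; first exact: mod_hom0.
by rewrite mulmx0 [g]thinmx0.
Qed.

(** Gives the relation [V] = [V] + [V], by which the class of a zero module vanishes. *)
Lemma zero_exact (V : module B) : mdim V = 0%N -> short_exact V V V.
Proof.
move=> V0; exists 0, 0.
have eq0 (u : 'cV[S]_(mdim V)) : u = 0.
  by apply/colP => -[i i_lt]; exfalso; rewrite V0 in i_lt.
split=> [|||w|v]; [exact: mod_hom0 | exact: mod_hom0 | by [] | |].
  by exists 0; rewrite [LHS]eq0 [RHS]eq0.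
by rewrite !mul0mx; split=> // _; exists 0; rewrite [LHS]eq0 [RHS]eq0.
Qed.

Lemma iso_exact (V W : module B) : mod_iso V W -> short_exact W V zeromod.
Proof.
move=> [f [g [hf hg gf fg]]]; exists f, 0.
have [||||? ? ?] := @split_exact _ _ _ _ f (0 : 'M_(mdim zeromod, _)) g 0.
- by rewrite mul0mx.
- by rewrite [LHS]flatmx0 [RHS]flatmx0.
- by [].
- by rewrite mulmx0 addr0.
by split=> //; apply: mod_hom0.
Qed.

End ZeroModule.

Section Classes.
Variables (F : fieldType) (B : freeAlg F).
Implicit Types (V W : module B) (P Q : projmod B).

Lemma G0cl_exact V V' V'' : short_exact V V' V'' -> G0cl V = G0cl V' + G0cl V''.
Proof. exact: gclass_exact. Qed.

Lemma K0cl_exact P P' P'' : short_exact P P' P'' -> K0cl P = K0cl P' + K0cl P''.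
Proof. exact: (@gclass_exact _ (@proj_exact F B)). Qed.

Lemma G0cl0 V : mdim V = 0%N -> G0cl V = 0.
Proof. by move=> /zero_exact/G0cl_exact/eqP; rewrite -subr_eq subrr => /eqP <-. Qed.

Lemma K0cl0 P : mdim P = 0%N -> K0cl P = 0.
Proof. by move=> /zero_exact/K0cl_exact/eqP; rewrite -subr_eq subrr => /eqP <-. Qed.

Lemma G0cl_iso V W : mod_iso V W -> G0cl V = G0cl W.
Proof. by move=> /iso_exact/G0cl_exact ->; rewrite [G0cl (zeromod _)]G0cl0 ?addr0. Qed.

Lemma K0cl_iso P Q : mod_iso P Q -> K0cl P = K0cl Q.
Proof.
pose Z := ProjMod (@zeromod_projective _ B).
move=> /iso_exact exPQ; rewrite (@K0cl_exact Q P Z exPQ).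
by rewrite [K0cl Z]K0cl0 ?addr0.
Qed.

Lemma intertwining_l_zmod y : zmod_morphism (fun x => @intertwining F B x y).
Proof. by move=> x x'; rewrite /intertwining raddfB. Qed.

Lemma intertwining_r_zmod x : zmod_morphism (@intertwining F B x).
Proof.
move=> y y'; move: x; apply: groth_ind => [|x x' hx hx'|P].
- by rewrite /intertwining !raddf0 subrr.
- rewrite !intertwining_l_zmod hx hx' !opprB addrACA [in RHS]addrACA.
  by congr (_ + _); apply: addrC.
by rewrite /intertwining !gmorphE raddfB.
Qed.

HB.instance Definition _ x := GRing.isZmodMorphism.Build (G0 B) int
  (@intertwining F B x) (intertwining_r_zmod x).

(** Arguments are exchanged so that additivity in the first variable can be attached to a constant;
    [intertwining] carries additivity in the second. *)
Definition intertwining_l y x := @intertwining F B x y.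

HB.instance Definition _ y := GRing.isZmodMorphism.Build (K0 B) int
  (intertwining_l y) (intertwining_l_zmod y).

Lemma intertwining_sumr P (l : seq (module B)) :
  intertwining (K0cl P) (\sum_(V <- l) G0cl V) = (\sum_(V <- l) hom_dim P V)%:Z.
Proof.
rewrite raddf_sum (big_morph Posz PoszD (erefl _)); apply: eq_bigr => V _.
exact: intertwiningE.
Qed.

Lemma intertwining_suml (l : seq (projmod B)) V :
  intertwining (\sum_(P <- l) K0cl P) (G0cl V) = (\sum_(P <- l) hom_dim P V)%:Z.
Proof.
rewrite -[LHS]/(intertwining_l (G0cl V) _) raddf_sum (big_morph Posz PoszD (erefl _)).
by apply: eq_bigr => P _; apply: intertwiningE.
Qed.

End Classes.

Lemma composition_series (F : fieldType) (B : freeAlg F) (V : module B) :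
  exists2 l : seq (module B), {in l, forall T, mod_simple T} &
    G0cl V = \sum_(T <- l) G0cl T.
Proof.
have [n] := ubnP (mdim V); elim: n V => // n IHn V Vn.
have [V0|V0] := posnP (mdim V).
  by exists [::] => //; rewrite big_nil G0cl0.
have [T [Y [Z [simT hY YZ]]]] := simple_quotient V0.
have [V' [X [N [V'dim hX NX YX XN]]]] := ker_exact hY YZ.
have V'n : (mdim V' < n)%N.
  rewrite -ltnS; apply: leq_trans Vn; rewrite ltnS V'dim -subn_gt0 subKn.
    by case: simT.
  have /eqP <- : row_free Y by apply/row_freeP; exists Z.
  exact: rank_leq_col.
have [l sl lE] := IHn V' V'n; exists (T :: l).
  by move=> U; rewrite inE => /predU1P[->|/sl].
by rewrite big_cons (G0cl_exact (ker_short_exact hY hX YZ NX YX XN)) lE addrC.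
Qed.

Section Covers.
Variables (F : fieldType) (B : freeAlg F).

(** The last clause expresses that pi is essential, in the form in which it is used: endomorphisms
    of P over S are invertible. *)
Definition proj_cover (P S : module B) pi : Prop :=
  [/\ mod_projective P, mod_simple S, @mod_hom _ _ P S pi, pi <> 0 &
      forall h, @mod_hom _ _ P P h -> pi *m h = pi -> h \in unitmx].

(* Among the corners with a nonzero map pi to S take one of minimal dimension,
   and among its endomorphisms fixing pi one, h, of minimal rank.  Then h^2 has
   the same rank as h, so that the image of h is a corner with a nonzero map to
   S, and by minimality h is invertible. *)
Lemma cover_exists (S : module B) : mod_simple S ->
  exists e (P : module B) pi, corner e P /\ @proj_cover P S pi.
Proof.
move=> simS; pose nonzero_hom (P : module B) := exists2 pi, @mod_hom _ _ P S pi & pi <> 0.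
pose Q n := `[< exists e P, [/\ corner e P, nonzero_hom P & mdim P = n] >].
have exQ : exists n, Q n.
  exists (arank B); apply/asboolP; exists 1, (regmod B); split=> //.
    exists 1%:M, 1%:M; rewrite mulmx1 rmulmx1.
    by split=> //; apply: mod_hom1.
  have [S0 _] := simS; exists (orbmx (delta_mx (Ordinal S0) 0)).
    exact: orbmx_hom.
  move=> /(congr1 (mulmxr (acol 1))) /=; rewrite orbmxE mact1 mul1mx mul0mx.
  by move=> /colP/(_ (Ordinal S0))/eqP; rewrite !mxE !eqxx oner_eq0.
case: (ex_minnP exQ) => n /asboolP[e [P [cP [pi hpi pi0] Pn]]] nmin.
have projP := corner_projective cP.
pose Q' r := `[< exists h, [/\ @mod_hom _ _ P P h, pi *m h = pi & \rank h = r] >].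
have exQ' : exists r, Q' r.
  exists (\rank (1%:M : 'M[F]_(mdim P))); apply/asboolP; exists 1%:M.
  by rewrite mulmx1; split=> //; apply: mod_hom1.
case: (ex_minnP exQ') => r /asboolP[h [hh pih hr]] rmin.
suff Pr : (mdim P <= r)%N.
  exists e, P, pi; split=> //; split=> // h' hh' pih'.
  rewrite -row_free_unit -row_leq_rank; apply: leq_trans Pr _.
  by apply: rmin; apply/asboolP; exists h'.
have hh2 : (\rank h <= \rank (h *m h))%N.
  rewrite [X in (X <= _)%N]hr; apply: rmin; apply/asboolP; exists (h *m h).
  by split=> //; [apply: mod_hom_comp | rewrite mulmxA !pih].
have [r' [X [N [G [r'E hE NX Gu]]]]] := fitting hh2.
(* X = h X G^-1 and N = G^-1 N h, so the image of X and the kernel of N inherit stability from h. *)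
have stab b : mact P b *m X = X *m (N *m mact P b *m X).
  have [K bX] : exists K, mact P b *m X = X *m K.
    exists (G *m N *m mact P b *m X *m invmx G); have := hh b; rewrite hE.
    move=> /(congr1 (mulmxr (X *m invmx G))) /=; rewrite !mulmxA => <-.
    by rewrite -(mulmxA _ N X) NX mulmx1 mulmxK.
  by rewrite -(mulmxA N) bX (mulmxA N) NX mul1mx.
have stab' b : N *m mact P b = N *m mact P b *m X *m N.
  have [K bN] : exists K, N *m mact P b = K *m N.
    exists (invmx G *m N *m mact P b *m X *m G); have := hh b; rewrite hE.
    move=> /(congr1 (mulmx (invmx G *m N))) /=; rewrite !mulmxA => ->.
    by rewrite -(mulmxA _ N X) NX mulmx1 mulVmx // mul1mx.
  by rewrite bN -(mulmxA K) NX mulmx1.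
pose P' := submod NX stab.
have hX : @mod_hom _ _ P' P X by apply: submod_hom.
have hN : @mod_hom _ _ P P' N by move=> b; rewrite [RHS]stab'.
have [X1 [N1 [hX1 hN1 NX1 _]]] := cP.
have [e' cP'] : exists e', corner e' P'.
  apply: (summand_corner (mod_hom_comp hX1 hX) (mod_hom_comp hN hN1)).
  by rewrite mulmxA -(mulmxA N) NX1 mulmx1.
rewrite Pn -hr -r'E; apply: nmin; apply/asboolP; exists e', P'; split=> //.
exists (pi *m X); first exact: mod_hom_comp.
by move=> piX; apply: pi0; rewrite -pih hE !mulmxA piX !mul0mx.
Qed.

(** Since pi is essential, ker pi lies in every maximal submodule of P; so f vanishes on ker pi. *)
Lemma cover_factor (P S T : module B) pi f :
    @proj_cover P S pi -> mod_simple T -> @mod_hom _ _ P T f ->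
  exists2 phi, @mod_hom _ _ S T phi & f = phi *m pi.
Proof.
move=> [projP simS hpi pi0 covP] simT hf.
have [->|f0] := eqVneq f 0.
  by exists 0; [exact: mod_hom0 | rewrite mul0mx].
have [Z piZ] := hom_to_simple hpi simS pi0.
have [K [X [N [_ hX NX piX XN]]]] := ker_exact hpi piZ.
suff fX : f *m X = 0.
  have fE : f = f *m Z *m pi.
    by rewrite -[LHS]mulmx1 -XN mulmxDr mulmxA fX mul0mx add0r mulmxA.
  exists (f *m Z) => // b; rewrite -[LHS]mulmx1 -piZ -[RHS]mulmx1 -[1%:M in RHS]piZ.
  rewrite !mulmxA -(mulmxA (mact T b)) -(mulmxA (mact T b)) -fE -(mulmxA _ (mact S b)).
  by rewrite hpi !mulmxA -fE hf.
apply: contrapT => fX; have [W fXW] := hom_to_simple (mod_hom_comp hf hX) simT fX.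
have [Z' fZ'] := hom_to_simple hf simT (elimN eqP f0).
have [K' [X' [N' [_ hX' NX' fX' XN']]]] := ker_exact hf fZ'.
have [piX'|piX'] := pselect (pi *m X' = 0).
  (* then ker f is contained in ker pi, which f maps onto T *)
  apply: pi0; have piE : pi = pi *m Z' *m f.
    by rewrite -[LHS]mulmx1 -XN' mulmxDr mulmxA piX' mul0mx add0r mulmxA.
  have : pi *m X *m W = 0 by rewrite piX mul0mx.
  rewrite {1}piE -!mulmxA (mulmxA f) fXW mulmx1 => piZ'.
  by rewrite piE piZ' mul0mx.
(* Otherwise ker f maps onto S, and pi lifts through it. The lift X' h is an endomorphism over S,
   hence invertible, although f kills its image. *)
have [|h hh piXh] := projP _ _ _ pi (mod_hom_comp hpi hX') hpi.
  have [Y piX'Y] := hom_to_simple (mod_hom_comp hpi hX') simS piX'.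
  by move=> w; exists (Y *m w); rewrite mulmxA piX'Y mul1mx.
have /covP : mod_hom (X' *m h) by apply: mod_hom_comp.
rewrite mulmxA piXh => /(_ erefl) Xhu; case/eqP: f0.
by rewrite -[f](mulmxK Xhu) !mulmxA fX' !mul0mx.
Qed.

Lemma cover_hom_iso (P S T : module B) pi : @proj_cover P S pi -> mod_simple T ->
  (0 < hom_dim P T)%N -> mod_iso S T.
Proof.
move=> covP simT /hom_dim_gt0[f hf f0]; have [_ simS _ _ _] := covP.
have [phi hphi fE] := cover_factor covP simT hf.
by apply: (schur simS simT hphi) => phi0; apply: f0; rewrite fE phi0 mul0mx.
Qed.

Lemma cover_hom_gt0 (P S : module B) pi : @proj_cover P S pi -> (0 < hom_dim P S)%N.
Proof. by move=> [_ _ hpi pi0 _]; apply/hom_dim_gt0; exists pi. Qed.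

Lemma cover_mdim_gt0 (P S : module B) pi : @proj_cover P S pi -> (0 < mdim P)%N.
Proof.
move=> [_ _ _ pi0 _]; rewrite lt0n; apply: contra_notN pi0 => /eqP P0.
by apply/matrixP => i [j j_lt]; exfalso; rewrite P0 in j_lt.
Qed.

(** Lift pi along f and f along pi by projectivity; the composite endomorphism of P fixes pi, hence
    is invertible. *)
Lemma cover_summand (P S Q : module B) pi f :
    @proj_cover P S pi -> mod_projective Q -> @mod_hom _ _ Q S f -> f <> 0 ->
  exists al ga, [/\ @mod_hom _ _ P Q al, @mod_hom _ _ Q P ga & ga *m al = 1%:M].
Proof.
move=> [projP simS hpi pi0 covP] projQ hf f0.
have surj V g : @mod_hom _ _ V S g -> g <> 0 -> forall w : 'cV_(mdim S), exists v, w = g *m v.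
  move=> hg /(hom_to_simple hg simS)[Y gY] w; exists (Y *m w).
  by rewrite mulmxA gY mul1mx.
have [al hal fal] := projP _ _ f pi hf hpi (surj _ _ hf f0).
have [be hbe pibe] := projQ _ _ pi f hpi hf (surj _ _ hpi pi0).
have hba := mod_hom_comp hbe hal.
have u : be *m al \in unitmx by apply: covP => //; rewrite mulmxA pibe.
exists al, (invmx (be *m al) *m be); split=> //; last by rewrite -mulmxA mulVmx.
apply: mod_hom_comp hbe; apply: inv_hom hba _ _; first exact: mulVmx.
exact: mulmxV.
Qed.

(** The cover identifies P by the simple module it detects; the idempotent turns dimensions of Hom
    into ranks. *)
Definition principal (P : module B) : Prop :=
  exists (S : module B) pi e, @proj_cover P S pi /\ corner e P.

Lemma projective_decomposition (Q : projmod B) :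
  exists2 l : seq (projmod B), {in l, forall P : projmod B, principal P} &
    K0cl Q = \sum_(P <- l) K0cl P.
Proof.
have [n] := ubnP (mdim Q); elim: n Q => // n IHn Q Qn.
have [Q0|Q0] := posnP (mdim Q).
  by exists [::] => //; rewrite big_nil K0cl0.
have [S [Y [Z [simS hY YZ]]]] := simple_quotient Q0.
have [e [P [pi [cP covP]]]] := cover_exists simS.
have [|al [ga [hal hga gaal]]] := cover_summand covP (@proj_valP _ _ Q) hY.
  move=> Y0; have [S0 _] := simS; move: YZ; rewrite Y0 mul0mx.
  by move=> /matrixP/(_ (Ordinal S0) (Ordinal S0))/eqP; rewrite !mxE eqxx eq_sym oner_eq0.
have [Q' [X [N [Q'dim hX NX gaX XN]]]] := ker_exact hga gaal.
(* As al is a morphism splitting ga, N is the projection along its image, hence a morphism too, and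
   Q' is a projective summand. *)
have Nal : N *m al = 0.
  have /(congr1 (mulmx N)) := XN; rewrite mulmxDr mulmxA NX mul1mx mulmx1.
  move=> /(congr1 (mulmxr al)) /=; rewrite mulmxDl -!mulmxA gaal mulmx1.
  by move=> /eqP; rewrite -subr_eq0 addrAC subrr add0r => /eqP.
have hN : @mod_hom _ _ Q Q' N.
  move=> b; rewrite -[LHS]mul1mx -NX -!mulmxA (mulmxA X) -hX -!mulmxA.
  have -> : X *m N = 1%:M - al *m ga by rewrite -XN addrK.
  rewrite !mulmxBr !mulmx1 (mulmxA (mact Q b)) hal -(mulmxA al) !(mulmxA N) Nal.
  by rewrite !mul0mx subr0.
pose P1 := ProjMod (corner_projective cP).
pose Q1 := ProjMod (summand_projective hX hN NX (@proj_valP _ _ Q)).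
have Q'n : (mdim Q1 < n)%N.
  rewrite -ltnS; apply: leq_trans Qn; rewrite ltnS Q'dim -subn_gt0 subKn.
    exact: cover_mdim_gt0 covP.
  have /eqP <- : row_free ga by apply/row_freeP; exists al.
  exact: rank_leq_col.
have [l pl lE] := IHn Q1 Q'n; exists (P1 :: l).
  by move=> U; rewrite inE => /predU1P[->|/pl //]; exists S, pi, e.
rewrite big_cons addrC -lE; apply: K0cl_exact.
exact: (@ker_short_exact _ _ _ P Q' ga al X N).
Qed.

Lemma G0_ind (Phi : G0 B -> Prop) :
    Phi 0 -> (forall x y, Phi x -> Phi y -> Phi (x - y)) ->
    (forall T, mod_simple T -> Phi (G0cl T)) ->
  forall x, Phi x.
Proof.
move=> Phi0 PhiB PhiS; apply: groth_ind => // V.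
have [l sl VE] := composition_series V; rewrite -[gclass V]/(G0cl V) VE.
rewrite big_seq; apply: big_ind => // [x y hx hy|T /sl /PhiS //].
by rewrite -[y]opprK; apply: (PhiB _ _ hx); rewrite -sub0r; apply: PhiB.
Qed.

Lemma K0_ind (Phi : K0 B -> Prop) :
    Phi 0 -> (forall x y, Phi x -> Phi y -> Phi (x - y)) ->
    (forall P : projmod B, principal P -> Phi (K0cl P)) ->
  forall x, Phi x.
Proof.
move=> Phi0 PhiB PhiP; apply: groth_ind => // Q.
have [l pl QE] := projective_decomposition Q; rewrite -[gclass Q]/(K0cl Q) QE.
rewrite big_seq; apply: big_ind => // [x y hx hy|P /pl /PhiP //].
by rewrite -[y]opprK; apply: (PhiB _ _ hx); rewrite -sub0r; apply: PhiB.
Qed.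

End Covers.

(** * Non-degeneracy of the intertwining form *)

Section Nondegeneracy.
Variables (F : fieldType) (B : freeAlg F).

Lemma G0_diff (x : G0 B) : exists l1 l2 : seq (module B),
  [/\ {in l1, forall T, mod_simple T}, {in l2, forall T, mod_simple T} &
      x = \sum_(T <- l1) G0cl T - \sum_(T <- l2) G0cl T].
Proof.
elim/G0_ind: x => [|x y [l1 [l2 [s1 s2 ->]]] [l3 [l4 [s3 s4 ->]]]|T simT].
- by exists [::], [::]; rewrite !big_nil subrr.
- exists (l1 ++ l4), (l2 ++ l3); rewrite !big_cat /= opprB addrACA opprD.
  by split=> // T; rewrite mem_cat => /orP[] h; auto.
exists [:: T], [::]; rewrite big_seq1 big_nil subr0; split=> // U.
by rewrite inE => /eqP ->.
Qed.

Lemma K0_diff (x : K0 B) : exists l1 l2 : seq (projmod B),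
  [/\ {in l1, forall P : projmod B, principal P},
      {in l2, forall P : projmod B, principal P} &
      x = \sum_(P <- l1) K0cl P - \sum_(P <- l2) K0cl P].
Proof.
elim/K0_ind: x => [|x y [l1 [l2 [s1 s2 ->]]] [l3 [l4 [s3 s4 ->]]]|P pP].
- by exists [::], [::]; rewrite !big_nil subrr.
- exists (l1 ++ l4), (l2 ++ l3); rewrite !big_cat /= opprB addrACA opprD.
  by split=> // P; rewrite mem_cat => /orP[] h; auto.
exists [:: P], [::]; rewrite big_seq1 big_nil subr0; split=> // U.
by rewrite inE => /eqP ->.
Qed.

Lemma sumn_gt0_seq (T : eqType) (l : seq T) (f : T -> nat) :
  (0 < \sum_(x <- l) f x)%N -> exists2 x, x \in l & (0 < f x)%N.
Proof.
elim: l => [|y l IHl]; first by rewrite big_nil.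
rewrite big_cons addn_gt0 => /orP[fy|/IHl[x xl fx]].
  by exists y; rewrite ?mem_head.
by exists x; rewrite // inE xl orbT.
Qed.

(** Terms cancel one at a time: the cover of the first T pairs positively with some T' of [l2],
    which must be isomorphic to T. *)
Lemma G0_simple_sums (l1 l2 : seq (module B)) :
    {in l1, forall T, mod_simple T} -> {in l2, forall T, mod_simple T} ->
    (forall e (P : projmod B), corner e P ->
       intertwining (K0cl P) (\sum_(T <- l1) G0cl T) =
       intertwining (K0cl P) (\sum_(T <- l2) G0cl T)) ->
  \sum_(T <- l1) G0cl T = \sum_(T <- l2) G0cl T.
Proof.
elim: l1 l2 => [|T l1 IHl] l2 s1 s2 eq12.
  case: l2 s2 eq12 => // T l2 s2 eq12.
  have [e [P [pi [cP covP]]]] := cover_exists (s2 T (mem_head _ _)).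
  have := eq12 e (ProjMod (corner_projective cP)) cP.
  rewrite big_nil raddf0 intertwining_sumr => /esym/eqP.
  by rewrite big_cons eqz_nat addn_eq0 -leqn0 leqNgt (cover_hom_gt0 covP).
have simT := s1 T (mem_head _ _).
have [e [P [pi [cP covP]]]] := cover_exists simT.
have := eq12 e (ProjMod (corner_projective cP)) cP.
rewrite !intertwining_sumr => -[eqT].
have [|T' T'l2 PT'] := @sumn_gt0_seq _ l2 (hom_dim P).
  by rewrite -eqT big_cons addn_gt0 (cover_hom_gt0 covP).
have TT' : G0cl T = G0cl T' by apply/G0cl_iso/(cover_hom_iso covP _ PT')/s2.
have l2E : \sum_(T <- l2) G0cl T = G0cl T + \sum_(T <- rem T' l2) G0cl T.
  by rewrite (perm_big _ (perm_to_rem T'l2)) big_cons TT'.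
rewrite big_cons l2E; congr (_ + _); apply: IHl => [U Ul|U /mem_rem/s2 //|f Q cQ].
  by apply: s1; rewrite inE Ul orbT.
have := eq12 f Q cQ; rewrite l2E big_cons !raddfD => /addrI //.
Qed.

(** Dually, a P' of [l2] with a non-zero map to S covers a module isomorphic to S. Each of P and P'
    is then a summand of the other, so their dimensions agree and the splitting is an
    isomorphism. *)
Lemma K0_principal_sums (l1 l2 : seq (projmod B)) :
    {in l1, forall P : projmod B, principal P} ->
    {in l2, forall P : projmod B, principal P} ->
    (forall V : module B,
       intertwining (\sum_(P <- l1) K0cl P) (G0cl V) =
       intertwining (\sum_(P <- l2) K0cl P) (G0cl V)) ->
  \sum_(P <- l1) K0cl P = \sum_(P <- l2) K0cl P.
Proof.
elim: l1 l2 => [|P l1 IHl] l2 s1 s2 eq12.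
  case: l2 s2 eq12 => // P l2 s2 eq12.
  have [S [pi [e [covP cP]]]] := s2 P (mem_head _ _).
  have := eq12 S; rewrite !intertwining_suml big_nil big_cons => /esym/eqP.
  by rewrite eqz_nat addn_eq0 -leqn0 leqNgt (cover_hom_gt0 covP).
have [S [pi [e [covP cP]]]] := s1 P (mem_head _ _).
have := eq12 S; rewrite !intertwining_suml => -[eqS].
have [|P' P'l2 P'S] := @sumn_gt0_seq _ l2 (fun P0 : projmod B => hom_dim P0 S).
  by rewrite -eqS big_cons addn_gt0 (cover_hom_gt0 covP).
have [S' [pi' [e' [covP' cP']]]] := s2 P' P'l2.
have PP' : K0cl P = K0cl P'.
  have [_ simS hpi pi0 _] := covP; have [_ simS' hpi' pi'0 _] := covP'.
  have [h hh h0] := (hom_dim_gt0 _ _).1 P'S.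
  have [al [ga [hal hga gaal]]] := cover_summand covP (@proj_valP _ _ P') hh h0.
  have [f [g [hf hg gf fg]]] := cover_hom_iso covP' simS P'S.
  have gpi0 : g *m pi <> 0.
    by move=> /(congr1 (mulmx f)); rewrite mulmx0 mulmxA fg mul1mx.
  have [be [de [_ _ debe]]] :=
    cover_summand covP' (@proj_valP _ _ P) (mod_hom_comp hg hpi) gpi0.
  have leq_rinv m n (X : 'M[F]_(m, n)) Y : X *m Y = 1%:M -> (m <= n)%N.
    move=> XY; have /eqP <- : row_free X by apply/row_freeP; exists Y.
    exact: rank_leq_col.
  have dimP : mdim P = mdim P'.
    by apply/eqP; rewrite eqn_leq (leq_rinv _ _ _ _ gaal) (leq_rinv _ _ _ _ debe).
  apply: K0cl_iso; exists al, ga; split=> //.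
  clear -gaal dimP; move: al ga gaal; rewrite dimP => al ga.
  exact: mulmx1C.
have l2E : \sum_(P <- l2) K0cl P = K0cl P + \sum_(P <- rem P' l2) K0cl P.
  by rewrite (perm_big _ (perm_to_rem P'l2)) big_cons PP'.
rewrite big_cons l2E; congr (_ + _); apply: IHl => [U Ul|U /mem_rem/s2 //|V].
  by apply: s1; rewrite inE Ul orbT.
have := eq12 V; rewrite l2E big_cons -!/(intertwining_l (G0cl V) _) !raddfD.
exact: addrI.
Qed.

Lemma G0_nondegenerate (x y : G0 B) :
    (forall e (P : projmod B), corner e P ->
       intertwining (K0cl P) x = intertwining (K0cl P) y) ->
  x = y.
Proof.
move=> xy; apply/eqP; rewrite -subr_eq0.
have [l1 [l2 [s1 s2 xyE]]] := G0_diff (x - y); rewrite xyE subr_eq0; apply/eqP.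
apply: G0_simple_sums => // e P cP; apply/eqP.
by rewrite -subr_eq0 -intertwining_r_zmod -xyE intertwining_r_zmod (xy e P cP) subrr.
Qed.

Lemma K0_nondegenerate (x y : K0 B) :
    (forall V, intertwining x (G0cl V) = intertwining y (G0cl V)) -> x = y.
Proof.
move=> xy; apply/eqP; rewrite -subr_eq0.
have [l1 [l2 [s1 s2 xyE]]] := K0_diff (x - y); rewrite xyE subr_eq0; apply/eqP.
apply: K0_principal_sums => // V; apply/eqP.
by rewrite -subr_eq0 -intertwining_l_zmod -xyE intertwining_l_zmod xy subrr.
Qed.

Lemma additive_K0_eq (Z : zmodType) (f g : {additive K0 B -> Z}) :
  (forall e (P : projmod B), corner e P -> f (K0cl P) = g (K0cl P)) -> f =1 g.
Proof.
move=> fg x; elim/K0_ind: x => [|x y hx hy|P [_ [_ [e [_ /fg]]]] //].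
  by rewrite !raddf0.
by rewrite !raddfB hx hy.
Qed.

End Nondegeneracy.

(** * Representability of additive functions over a split algebra *)

Section Split.
Variables (F : fieldType) (B : freeAlg F).
Hypothesis split : split_alg B.

(** Over an extension where h acquires an eigenvalue z, the row eigenvector is a non-zero form
    killing the image of h - z. On a module that remained simple this forces h = z. *)
Lemma split_endo (S : module B) h : mod_simple S -> @mod_hom _ _ S S h ->
  exists c, h = c%:M.
Proof.
move=> simS hh; have [S0 _] := simS.
have [|L [iota [z]]] := @root_extension F (char_poly h).
  by rewrite size_char_poly ltnS.
rewrite map_char_poly -eigenvalue_root_char => /eigenvalueP[v vE v0].
have simSL := split iota simS.
have hL : @mod_hom _ _ (mod_ext iota S) (mod_ext iota S) (map_mx iota h - z%:M).
  apply: mod_hom_basis => i; rewrite mulmxBr mulmxBl scalar_mxC; congr (_ - _).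
  rewrite /= mulmx_suml mulmx_sumr; apply: eq_bigr => j _.
  by rewrite -scalemxAl -scalemxAr -!map_mxM hh.
have hz : map_mx iota h = z%:M.
  apply/eqP; rewrite -subr_eq0; apply/eqP; apply: contrapT => h0.
  have [Y hY] := hom_to_simple hL simSL h0.
  have : v *m (map_mx iota h - z%:M) = 0.
    by rewrite mulmxBr vE mul_mx_scalar subrr.
  move=> /(congr1 (mulmxr Y)) /=; rewrite -mulmxA hY mulmx1 mul0mx.
  by move/eqP: v0.
(* The scalar z is the image of a diagonal entry of h, so it lies in F. *)
exists (h (Ordinal S0) (Ordinal S0)); apply/matrixP => i j; rewrite mxE.
have hij k l : iota (h k l) = z *+ (k == l) by have := congr1 (fun M : 'M_ _ => M k l) hz; rewrite !mxE.
apply: (fmorph_inj iota); apply: etrans (hij i j) _; rewrite raddfMn.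
by congr (_ *+ _); apply: esym; apply: etrans (hij _ _) _; rewrite eqxx.
Qed.

Lemma cover_hom_dim1 (P S : module B) pi : @proj_cover _ _ P S pi -> hom_dim P S = 1%N.
Proof.
move=> covP; have [_ simS hpi pi0 _] := covP.
suff -> : hom_dim P S = \dim <[pi]>%VS by rewrite dim_vline; case: eqP.
congr (\dim _); apply/vspaceP => X; apply/homvP/vlineP => [hX|[c ->] b]; last first.
  by rewrite -scalemxAr -scalemxAl hpi.
have [phi hphi XE] := cover_factor covP simS hX.
by have [c phiE] := split_endo simS hphi; exists c; rewrite XE phiE mul_scalar_mx.
Qed.

Lemma K0_represents (phi : {additive G0 B -> int}) :
  exists y : K0 B, forall x, intertwining y x = phi x.
Proof.
have [l0 sl0 regE] := composition_series (regmod B).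
suff [y yE] : exists y : K0 B, {in l0, forall T, intertwining y (G0cl T) = phi (G0cl T)}.
  exists y; elim/G0_ind => [|x x' hx hx'|S simS]; first by rewrite !raddf0.
    by rewrite intertwining_r_zmod raddfB hx hx'.
  have [e [P [pi [cP covP]]]] := cover_exists simS.
  (* P is a summand of B, so it has a non-zero map to some composition factor of B: [l0] meets every
     isomorphism class of simple modules. *)
  have [T Tl0 PT] : exists2 T, T \in l0 & (0 < hom_dim P T)%N.
    apply: (@sumn_gt0_seq _ l0 (hom_dim P)).
    have := intertwining_sumr (ProjMod (corner_projective cP)) l0.
    rewrite -regE intertwiningE => -[<-] /=; apply/hom_dim_gt0.
    have [X [N [hX _ NX _]]] := cP; exists X => // X0.
    have P0 := cover_mdim_gt0 covP; move: NX; rewrite X0 mulmx0.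
    move=> /matrixP/(_ (Ordinal P0) (Ordinal P0))/eqP.
    by rewrite !mxE eqxx eq_sym oner_eq0.
  by rewrite (G0cl_iso (cover_hom_iso covP (sl0 _ Tl0) PT)) yE.
elim: l0 sl0 {regE} => [|T l IHl] sl; first by exists 0.
have [|y yE] := IHl; first by move=> U Ul; apply: sl; rewrite inE Ul orbT.
(* If the class of T recurs in l, y is already correct there. Otherwise the cover of T pairs to zero
   with l, and a multiple of it corrects the value at T. *)
have [[T' T'l TT']|nT] := pselect (exists2 T', T' \in l & G0cl T = G0cl T').
  exists y => U; rewrite inE => /predU1P[->|/yE //].
  by rewrite TT' yE.
have [e [P [pi [cP covP]]]] := cover_exists (sl T (mem_head _ _)).
pose P1 := ProjMod (corner_projective cP).
exists (y + K0cl P1 *~ (phi (G0cl T) - intertwining y (G0cl T))) => U.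
have -> n : intertwining (y + K0cl P1 *~ n) (G0cl U) =
    intertwining y (G0cl U) + (hom_dim P U)%:Z *~ n.
  rewrite -[LHS]/(intertwining_l (G0cl U) _) raddfD raddfMz.
  by congr (_ + _ *~ _); apply: intertwiningE.
rewrite inE => /predU1P[->|Ul].
  by rewrite (cover_hom_dim1 covP) intz addrC subrK.
have -> : hom_dim P U = 0%N.
  apply/eqP; rewrite -leqn0 leqNgt; apply/negP => PU; apply: nT; exists U => //.
  by apply/G0cl_iso/(cover_hom_iso covP _ PU)/sl; rewrite inE Ul orbT.
by rewrite mul0rz addr0; apply: yE.
Qed.

End Split.

(** * Bimodules over a split algebra *)

(* [bright] is the right action. *)
Record bimod (S : comNzRingType) (B : freeAlg S) := Bimod {
  bmod :> module B;
  bright : B -> 'M[S]_(mdim bmod);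
  bright_lin : forall (s : S) (a b : B),
    bright (ascal B s * a + b) = s *: bright a + bright b;
  bright1 : bright 1 = 1%:M;
  brightM : forall a b : B, bright (a * b) = bright b *m bright a;
  brightC : forall a b : B, mact bmod a *m bright b = bright b *m mact bmod a
}.
Arguments bright {S B} b : rename.

Definition regbimod (S : comNzRingType) (B : freeAlg S) : bimod B :=
  @Bimod S B (regmod B) (@rmulmx S B) (@rmulmx_lin S B) (@rmulmx1 S B)
    (@rmulmxM S B) (fun a b => rmulmx_hom b a).

Section Density.
Variables (F : fieldType) (B : freeAlg F) (V T : module B).
Hypothesis simT : mod_simple T.
Hypothesis scalT : forall h, @mod_hom _ _ T T h -> exists c, h = c%:M.

(** Jacobson density: independent morphisms map V onto T^d. Indexing by bounded naturals lets the
    induction drop the last morphism without casts. *)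
Lemma density (d : nat) (h : nat -> 'M[F]_(mdim T, mdim V)) :
    (forall i, (i < d)%N -> mod_hom (h i)) ->
    (forall c : nat -> F, \sum_(j < d) c j *: h j = 0 ->
       forall j, (j < d)%N -> c j = 0) ->
  exists Q : nat -> 'M_(mdim V, mdim T),
    forall i j, (i < d)%N -> (j < d)%N -> h i *m Q j = (i == j)%:R%:M.
Proof.
elim: d => [|d IHd] hh indep; first by exists (fun=> 0).
have [|c hc j jd|Q hQ] := IHd; first by move=> i /ltnW; apply: hh.
  have := indep (fun i => if (i < d)%N then c i else 0).
  rewrite big_ord_recr /= ltnn scale0r addr0.
  under eq_bigr => i _ do rewrite ltn_ord.
  by move=> /(_ hc j (ltnW jd)); rewrite jd.
have [[u [hu hdu]]|nu] := pselect (exists u : 'cV_(mdim V),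
    (forall i, (i < d)%N -> h i *m u = 0) /\ h d *m u <> 0).
  (* Translates of u give a W with h_d W = 1 that the other h_i kill; W then corrects the old
     Q_j. *)
  have /choice[f fE] (j : 'I_(mdim T)) : exists b, mact T b *m (h d *m u) = col j 1%:M.
    exact: simple_cyclic.
  pose W := \matrix_(i, j) (mact V (f j) *m u) i 0.
  have colW j : col j W = mact V (f j) *m u by apply/colP => i; rewrite !mxE.
  have hW i : (i < d)%N -> h i *m W = 0.
    move=> id; apply: eq_colP => j; rewrite col_mul colW mulmxA -hh ?ltnS 1?ltnW //.
    by rewrite -mulmxA hu // mulmx0 linear0.
  have hdW : h d *m W = 1%:M.
    by apply: eq_colP => j; rewrite col_mul colW mulmxA -hh // -mulmxA fE.
  exists (fun j => if j == d then W else Q j - W *m (h d *m Q j)) => i j.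
  rewrite !ltnS => id jd; have [->|jd'] := eqVneq j d.
    have [->|id'] := eqVneq i d; first exact: hdW.
    by rewrite hW ?raddf0 // ltn_neqAle id'.
  have jd'' : (j < d)%N by rewrite ltn_neqAle jd'.
  rewrite mulmxBr mulmxA; have [->|id'] := eqVneq i d.
    by rewrite hdW mul1mx subrr eq_sym (negPf jd') raddf0.
  by rewrite hW ?mul0mx ?subr0 ?hQ // ltn_neqAle id'.
have kerd m (M : 'M_(mdim V, m)) : (forall i, (i < d)%N -> h i *m M = 0) -> h d *m M = 0.
  move=> hM; apply: eq_colP => j; rewrite col_mul linear0; apply: contrapT => hdM.
  by apply: nu; exists (col j M); split=> // i id; rewrite -col_mul hM ?linear0.
(* Q_j is not a morphism, but its failure to commute with b lies in the common kernel of the h_i, i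
   < d, which h_d kills by [kerd]. So h_d Q_j is an endomorphism of T, hence scalar. *)
have /choice[c cE] (j : nat) : exists c, (j < d)%N -> h d *m Q j = c%:M.
  have [jd|jd] := ltnP j d; last by exists 0.
  have [|c cE] := scalT (h := h d *m Q j); last by exists c.
  move=> b; apply/eqP; rewrite -subr_eq0 mulmxA hh // -!mulmxA -mulmxBr.
  apply/eqP/kerd => i id; rewrite mulmxBr !mulmxA -hh 1?ltnW // -(mulmxA (mact T b)) !hQ //.
  by rewrite scalar_mxC subrr.
have := indep (fun i => if (i < d)%N then - c i else 1).
rewrite big_ord_recr /= ltnn scale1r.
under eq_bigr => i _ do rewrite ltn_ord.
have hdE : h d = \sum_(j < d) c j *: h j.
  apply/eqP; rewrite -subr_eq0; apply/eqP.
  have -> : h d - \sum_(j < d) c j *: h j = h d *m (1%:M - \sum_(j < d) Q j *m h j).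
    rewrite mulmxBr mulmx1 mulmx_sumr; congr (_ - _); apply: eq_bigr => j _.
    by rewrite mulmxA cE // mul_scalar_mx.
  apply: kerd => i id; rewrite mulmxBr mulmx1 mulmx_sumr (bigD1 (Ordinal id)) //=.
  rewrite mulmxA hQ // eqxx mul1mx big1 ?addr0 ?subrr // => j ji.
  rewrite mulmxA hQ // (_ : (i == j :> nat) = false) ?raddf0 ?mul0mx //.
  by apply: contraNF ji => /eqP ij; apply/eqP/val_inj.
under eq_bigr => i _ do rewrite scaleNr.
rewrite sumrN -hdE addNr => /(_ erefl d (ltnSn d)).
by rewrite ltnn => /eqP; rewrite oner_eq0.
Qed.

End Density.

Section BimoduleFiltration.
Variables (F : fieldType) (B : freeAlg F).
Hypothesis split : split_alg B.

Section Quotient.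
Variables (M : bimod B) (T : module B).
Hypothesis simT : mod_simple T.
Local Notation H := (homv M T).
Local Notation d := (\dim H).
Local Notation hb := (vbasis H).

(* Hom(M, T) is a left module through the right action on M. *)
Definition homact (b : B) : 'M[F]_d :=
  \matrix_(k, j) coord hb k (hb`_j *m bright M b).

Lemma hom_basis i : (i < d)%N -> mod_hom (hb`_i).
Proof.
by move=> id; apply/homvP/vbasis_mem/mem_nth; rewrite size_tuple.
Qed.

Lemma homactE b (j : 'I_d) :
  hb`_j *m bright M b = \sum_k homact b k j *: hb`_k.
Proof.
have : hb`_j *m bright M b \in H.
  apply/homvP => a; rewrite mulmxA hom_basis // -!mulmxA.
  by rewrite brightC.
move/coord_vbasis => {1}->; apply: eq_bigr => k _.
by rewrite mxE.
Qed.

Lemma hom_basis_inj (v w : 'I_d -> F) :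
  \sum_k v k *: hb`_k = \sum_k w k *: hb`_k -> v =1 w.
Proof.
move=> vw k; apply/eqP; rewrite -subr_eq0; apply/eqP.
have /freeP/(_ (fun k => v k - w k)) fr := basis_free (vbasisP H).
apply: fr; under eq_bigr => i _ do rewrite scalerBl.
by rewrite sumrB vw subrr.
Qed.

Lemma homact_lin s (a b : B) :
  homact (ascal B s * a + b) = s *: homact a + homact b.
Proof.
apply/matrixP => k j; rewrite !mxE bright_lin mulmxDr -scalemxAr.
by rewrite linearP.
Qed.

Lemma homact1 : homact 1 = 1%:M.
Proof.
apply/matrixP => k j; move: k.
apply: (hom_basis_inj (v := homact 1 ^~ j) (w := (1%:M : 'M_d) ^~ j)).
rewrite -homactE bright1 mulmx1 (bigD1 j) //= mxE eqxx scale1r big1 ?addr0 // => k.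
by rewrite mxE => /negPf ->; rewrite scale0r.
Qed.

Lemma homactM (a b : B) : homact (a * b) = homact a *m homact b.
Proof.
apply/matrixP => k j; move: k.
apply: (hom_basis_inj (v := homact (a * b) ^~ j) (w := (homact a *m homact b) ^~ j)).
rewrite -homactE brightM mulmxA homactE mulmx_suml.
under eq_bigr => k _ do rewrite -scalemxAl homactE scaler_sumr.
rewrite exchange_big /=; apply: eq_bigr => k _.
rewrite mxE scaler_suml; apply: eq_bigr => i _.
by rewrite scalerA mulrC.
Qed.

Definition hommod : module B := Module homact_lin homact1 homactM.

(** Evaluation from M to T (x) Hom(M, T)^*: column j of the target matrix is the value of the j-th
    basis morphism. *)
Definition homeval : 'M[F]_(mdim T * d, mdim M) :=
  \matrix_(i, k) (mxvec (\matrix_(p, j) hb`_j p k : 'M_(mdim T, d))) 0 i.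

Lemma homevalE (v : 'cV_(mdim M)) :
  homeval *m v = (mxvec (\matrix_(p, j) (hb`_j *m v) p 0 : 'M_(mdim T, d)))^T.
Proof.
apply/colP => i; rewrite !mxE; case/mxvec_indexP: i => p j.
by rewrite mxvecE !mxE; apply: eq_bigr => k _; rewrite mxE mxvecE mxE.
Qed.

Lemma homeval_act a b :
  homeval *m (mact M a *m bright M b) =
  sandmx (mact T a) (mact hommod b) *m homeval.
Proof.
apply: eq_colP => i; rewrite !colE; move: (delta_mx i 0) => v.
rewrite -!mulmxA !homevalE sandmxE; congr (mxvec _)^T; apply/matrixP => p j.
rewrite mxE !mulmxA -hom_basis // -!mulmxA (mulmxA hb`_j) homactE.
rewrite [LHS]mxE [RHS]mxE; apply: eq_bigr => q _; congr (_ * _).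
rewrite mulmx_suml summxE mxE; apply: eq_bigr => k _.
by rewrite -scalemxAl !mxE mulrC.
Qed.

Lemma homeval_rinv : exists Psi, homeval *m Psi = 1%:M.
Proof.
have [||Q hQ] := @density _ _ M T simT (fun h => split_endo split simT) d (fun i => hb`_i).
- by move=> i; apply: hom_basis.
- move=> c hc j jd; have := @hom_basis_inj (fun k => c k) (fun=> 0).
  move=> /(_ _ (Ordinal jd)); apply; rewrite hc big1 // => k _.
  by rewrite scale0r.
have [i|Psi] := @col_solve _ _ _ _ homeval 1%:M; last by exists Psi.
have [x xE] : exists x : 'M[F]_(mdim T, d), col i 1%:M = (mxvec x)^T.
  by exists (vec_mx (col i 1%:M)^T); rewrite vec_mxK trmxK.
exists (\sum_(j < d) Q j *m col j x); rewrite homevalE.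
rewrite xE; congr (mxvec _)^T.
apply/matrixP => p j; rewrite [RHS]mxE mulmx_sumr summxE (bigD1 j) //= mulmxA hQ //.
rewrite eqxx mul1mx mxE big1 ?addr0 // => k kj; rewrite mulmxA hQ //.
have -> : (j == k :> nat) = false.
  by apply: contraNF kj => /eqP jk; apply/eqP/val_inj.
by rewrite raddf0 mul0mx mxE.
Qed.

End Quotient.

(* T (x) Hom(M, T)^* is a quotient bimodule of M. *)
Lemma bimod_filtration (M : bimod B) : exists l : seq (module B * module B),
  forall a b, rchar (mact M a *m bright M b) =
    \prod_(TS <- l) rchar (sandmx (mact TS.1 a) (mact TS.2 b)).
Proof.
have [n] := ubnP (mdim M); elim: n M => // n IHn M Mn.
have [M0|M0] := posnP (mdim M).
  exists [::] => a b; rewrite big_nil /rchar.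
  by move: (mact M a *m _); rewrite M0 => X; rewrite det_mx00.
have [T [Y [Z [simT hY YZ]]]] := simple_quotient M0.
have [T0 _] := simT.
have [Psi PhiPsi] := homeval_rinv M simT.
have [p [X [N [pE PhiX NX XN]]]] := split_of_rinv PhiPsi.
have PhiMX a b : homeval M T *m (mact M a *m bright M b *m X) = 0.
  by rewrite mulmxA homeval_act -mulmxA PhiX mulmx0.
have stab a b : mact M a *m bright M b *m X = X *m (N *m (mact M a *m bright M b *m X)).
  by rewrite -[LHS]mul1mx -XN mulmxDl -(mulmxA Psi) PhiMX mulmx0 addr0 !mulmxA.
(* Setting b or a to 1 separates stability under two-sided operators into stability under each
   action. *)
have stabl a : mact M a *m X = X *m (N *m mact M a *m X).
  by have := stab a 1; rewrite bright1 mulmx1 !mulmxA.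
have stabr b : bright M b *m X = X *m (N *m bright M b *m X).
  by have := stab 1 b; rewrite mact1 mul1mx !mulmxA.
pose r b := N *m bright M b *m X.
have rC a b : N *m mact M a *m X *m r b = r b *m (N *m mact M a *m X).
  rewrite /r -(mulmxA (N *m mact M a) X) -stabr.
  rewrite -(mulmxA (N *m bright M b) X) -stabl !mulmxA.
  by rewrite -(mulmxA N (mact M a)) brightC mulmxA.
have r_lin s a b : r (ascal B s * a + b) = s *: r a + r b.
  by rewrite /r bright_lin mulmxDr mulmxDl -scalemxAr -scalemxAl.
have r1 : r 1 = 1%:M by rewrite /r bright1 mulmx1.
have rM a b : r (a * b) = r b *m r a.
  by rewrite /r brightM -!mulmxA [in LHS]stabr !mulmxA.
pose M' := @Bimod F B (submod NX stabl) r r_lin r1 rM rC.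
have M'n : (mdim M' < n)%N.
  rewrite -ltnS; apply: leq_trans Mn; rewrite ltnS [mdim _]pE -subn_gt0 subKn.
    rewrite muln_gt0 T0; apply/hom_dim_gt0; exists Y => // Y0.
    move: YZ; rewrite Y0 mul0mx => /matrixP/(_ (Ordinal T0) (Ordinal T0))/eqP.
    by rewrite !mxE eqxx eq_sym oner_eq0.
  have /eqP <- : row_free (homeval M T) by apply/row_freeP; exists Psi.
  exact: rank_leq_col.
have [l lE] := IHn M' M'n; exists ((T, hommod M T) :: l) => a b.
have E1 : homeval M T *m (mact M a *m bright M b) *m Psi =
    sandmx (mact T a) (mact (hommod M T) b).
  by rewrite homeval_act -mulmxA PhiPsi mulmx1.
have E2 : N *m (mact M a *m bright M b) *m X = mact M' a *m bright M' b.
  rewrite -[RHS]/((N *m mact M a *m X) *m r b) /r -(mulmxA (N *m mact M a) X).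
  by rewrite -stabr !mulmxA.
by rewrite big_cons -lE (rchar_split XN PhiX NX PhiPsi) // E1 E2 [LHS]mulrC.
Qed.

End BimoduleFiltration.

(** * Lattices and decomposition maps *)

Section LatticeBasis.
Variables (K : fieldType) (v : discrete_valuation K).

Lemma dval_div_ge0 x y : x != 0 -> y != 0 -> v x <= v y -> in_valring v (y / x).
Proof.
move=> x0 y0 vxy; rewrite /in_valring.
have yE : y = y / x * x by rewrite divfK.
have yx0 : y / x != 0 by rewrite mulf_neq0 ?invr_eq0.
rewrite (negPf yx0) /=.
by move: vxy; rewrite {1}yE dvalM // lerDr.
Qed.

(** Stated by quotients rather than by comparing valuations, so as to cover f j = 0, whose valuation
    is arbitrary. *)
Lemma min_valuation (I : finType) (f : I -> K) i0 : f i0 != 0 ->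
  exists2 i, f i != 0 & forall j, in_valring v (f j / f i).
Proof.
move=> fi0; have [i fi imin] := Order.TotalTheory.arg_minP (P := fun i => f i != 0) (fun i => v (f i)) fi0.
exists i => // j; have [->|fj] := eqVneq (f j) 0.
  by rewrite mul0r /in_valring eqxx.
by apply: dval_div_ge0 => //; apply: imin.
Qed.

Lemma spanning_subbasis (n : nat) (I : finType) (u : I -> 'cV[K]_n) :
    (forall w, exists c : I -> K, w = \sum_i c i *: u i) ->
  exists f : {ffun 'I_n -> I}, \det (\matrix_(i, j) u (f j) i 0) != 0.
Proof.
move=> span; pose A := \matrix_(k < #|I|, j < n) u (enum_val k) j 0.
have fullA : row_full A.
  rewrite -sub1mx; apply/row_subP => j; have [c cE] := span (row j 1%:M)^T.
  apply/submxP; exists (\row_k c (enum_val k)).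
  rewrite -[LHS]trmxK cE; apply/rowP => i; rewrite !mxE summxE.
  rewrite (reindex (@enum_val I predT)) /=; last first.
    by apply: onW_bij; apply: enum_val_bij.
  by apply: eq_bigr => k _; rewrite !mxE.
exists [ffun j => enum_val (fullrankfun fullA j)].
rewrite -unitfE -unitmxE -unitmx_tr.
have := fullrowsub_unit fullA; congr (_ \in unitmx).
by apply/matrixP => i j; rewrite !mxE; congr (u _ _ _); rewrite [RHS]ffunE.
Qed.

(* Choose n of the given vectors with a determinant of minimal valuation: by
   Cramer's rule they form a basis of the lattice spanned by all of them. *)
Lemma lattice_basis (n : nat) (I : finType) (u : I -> 'cV[K]_n) :
    (forall w, exists c : I -> K, w = \sum_i c i *: u i) ->
  exists2 g : 'M[K]_n, g \in unitmx &
    (forall j, exists i, col j g = u i) /\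
    (forall i k, in_valring v ((invmx g *m u i) k 0)).
Proof.
move=> /spanning_subbasis[f0 f0P].
pose mx (f : {ffun 'I_n -> I}) : 'M[K]_n := \matrix_(i, j) u (f j) i 0.
have colmx f j : col j (mx f) = u (f j) by apply/colP => i; rewrite !mxE.
have [f fP fmin] := @min_valuation _ (fun f => \det (mx f)) f0 f0P.
have gu : mx f \in unitmx by rewrite unitmxE unitfE.
exists (mx f) => //; split=> [j|i k]; first by exists (f j).
pose x := invmx (mx f) *m u i; rewrite -/x.
pose f' := [ffun j => if j == k then i else f j].
have -> : x k 0 = \det (mx f') / \det (mx f); last exact: fmin.
(* Replacing column k is a rank-one perturbation; [det1_mulC] reduces the quotient of determinants
   to a 1 x 1 determinant. *)
have -> : mx f' = mx f *m (1%:M + (x - delta_mx k 0) *m (delta_mx k 0)^T).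
  rewrite mulmxDr mulmx1 mulmxA mulmxBr /x mulKVmx // -colE colmx.
  apply/matrixP => p q; rewrite !mxE big_ord1 !mxE ffunE eqxx andbT.
  by case: (eqVneq q k) => [->|]; rewrite ?mulr1 ?mulr0 ?addr0 // addrC subrK.
rewrite det_mulmx [\det _ * _]mulrC mulfK // det1_mulC.
have -> : 1%:M + (delta_mx k 0)^T *m (x - delta_mx k 0) = (x k 0)%:M.
  rewrite trmx_delta mulmxBr -rowE mul_delta_mx.
  by apply/matrixP => p q; rewrite !ord1 !mxE !eqxx addrC subrK.
by rewrite det_scalar1.
Qed.

End LatticeBasis.

Lemma map_poly_injective (S S' : comNzRingType) (f : {rmorphism S -> S'}) :
  injective f -> injective (map_poly f).
Proof.
move=> finj p q pq; apply/polyP => i; apply: finj.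
by have := congr1 (fun p : {poly S'} => p`_i) pq; rewrite !coef_map.
Qed.

Lemma map_mx_injective (S S' : comNzRingType) (f : {rmorphism S -> S'}) m n :
  injective f -> injective (@map_mx _ _ f m n).
Proof.
move=> finj A B AB; apply/matrixP => i j; apply: finj.
by have := congr1 (fun M : 'M_(_, _) => M i j) AB; rewrite !mxE.
Qed.

Section Lattices.
Variables (R : idomainType) (p : prime_idealr R) (A : freeAlg R).
Variable O : perfect_gate p A.

Local Notation toK := (@bcmap _ _ _ (dvr_map O) (@tofrac R) (valring_map O) A).
Local Notation tok := (@bcmap _ _ _ (dvr_map O) (dvr_residue O) (residue_map O) A).
Local Notation fib :=
  (@bcmap _ _ _ (kappa_map p) (dvr_residue O) (kappa_residue O) A).

Lemma valring_map_inj : injective (valring_map O).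
Proof. exact: val_inj. Qed.

Lemma valring_mx m n (M : 'M[{fraction R}]_(m, n)) :
  (forall i j, in_valring O (M i j)) -> exists L, map_mx (valring_map O) L = M.
Proof.
move=> MO; exists (\matrix_(i, j) (Sub (M i j) (MO i j) : valring O)).
by apply/matrixP => i j; rewrite !mxE.
Qed.

(** The inverse W records that the lattice basis is a K-basis, so that operators on V and on L are
    conjugate over K. *)
Definition full_lattice (V : module (alg_frac A)) (L : module (alg_dvr O A)) :=
  exists U W, [/\ is_lattice (V := V) (L := L) U, W *m U = 1%:M & U *m W = 1%:M].

Lemma toK_lin s (x y : alg_dvr O A) :
  toK (ascal (alg_dvr O A) s * x + y) =
  ascal (alg_frac A) (valring_map O s) * (toK x : alg_frac A) + toK y.
Proof.
rewrite [ascal _ s * x]bcscalE [ascal _ _ * _]bcscalE /bcmap map_mxD; congr (_ + _).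
exact: map_mxZ.
Qed.

Lemma full_lattice_exists (V : module (alg_frac A)) : exists L, full_lattice V L.
Proof.
have memO x : in_valring O x = (x \in in_valring O) by [].
(* Generators: the translates of the standard basis of V by the basis of A. Their O-span is stable
   under A. *)
pose u (ij : 'I_(arank A) * 'I_(mdim V)) : 'cV_(mdim V) :=
  mact V (bcin (@tofrac R) (abasis ij.1) : alg_frac A) *m delta_mx ij.2 0.
have actE (a : A) w : mact V (bcin (@tofrac R) a : alg_frac A) *m w =
    \sum_ij (tofrac (acoord a 0 ij.1) * w ij.2 0) *: u ij.
  rewrite mactE mulmx_suml -(pair_big xpredT xpredT
    (fun i j => (tofrac (acoord a 0 i) * w j 0) *: u (i, j))) /=.
  apply: eq_bigr => i _; rewrite -scalemxAl {1}[w]matrix_sum_delta mulmx_sumr.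
  rewrite scaler_sumr; apply: eq_bigr => j _.
  by rewrite big_ord1 -scalemxAr scalerA mxE bc_abasis.
have [|g gu [gcol gO]] := @lattice_basis _ O _ _ u.
  move=> w; exists (fun ij => tofrac (acoord (1 : A) 0 ij.1) * w ij.2 0).
  by rewrite -actE [bcin _ _](erefl (1 : alg_frac A)) mact1 mul1mx.
have basisO (a : A) i k : in_valring O
    ((invmx g *m (mact V (bcin (@tofrac R) a : alg_frac A) *m u i)) k 0).
  rewrite /u mulmxA -mactM [_ * _]bcmul_in actE mulmx_sumr summxE.
  rewrite memO; apply: rpred_sum => j _.
  rewrite -scalemxAr mxE; apply: rpredM => //; last exact: gO.
  apply: rpredM; first exact: dvr_in_fact.
  rewrite mxE; case: (_ && _) => /=; [exact: rpred1 | exact: rpred0].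
have actO (x : alg_dvr O A) :
    exists L, map_mx (valring_map O) L = invmx g *m mact V (toK x : alg_frac A) *m g.
  apply: valring_mx => k j; rewrite mactE mulmx_sumr mulmx_suml summxE.
  rewrite memO; apply: rpred_sum => i _.
  rewrite -scalemxAr -scalemxAl mxE; apply: rpredM.
    by rewrite mxE; apply: valP.
  have [l gj] := gcol j; have := basisO (@abasis _ A i) l k.
  by rewrite -gj -col_mul -col_mul mxE bc_abasis mulmxA.
have /choice[L LE] := actO.
have Linj := @map_mx_injective _ _ (valring_map O) (mdim V) (mdim V) valring_map_inj.
have L_lin s (x y : alg_dvr O A) : L (ascal _ s * x + y) = s *: L x + L y.
  apply: Linj; rewrite map_mxD map_mxZ !LE toK_lin mact_lin.
  by rewrite mulmxDr mulmxDl -scalemxAr -scalemxAl.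
have L1 : L 1 = 1%:M.
  apply: Linj; rewrite LE map_mx1.
  rewrite (_ : toK 1 = 1); last by apply: bcmap_bcin => r; apply: dvr_mapE.
  by rewrite mact1 mulmx1 mulVmx.
have LM (x y : alg_dvr O A) : L (x * y) = L x *m L y.
  apply: Linj; rewrite map_mxM !LE.
  rewrite (bcmapM (phi' := @tofrac R)); last by move=> r; apply: dvr_mapE.
  by rewrite mactM !mulmxA mulmxK.
exists (Module L_lin L1 LM), g, (invmx g); split; [split | exact: mulVmx | exact: mulmxV].
- move=> c /(congr1 (mulmx (invmx g))); rewrite mulKmx // mulmx0 => c0.
  by apply: (map_mx_injective valring_map_inj); rewrite c0 map_mx0.
- by move=> w; exists (invmx g *m w); rewrite mulKVmx.
by move=> x; rewrite /= LE !mulmxA mulmxV // mul1mx.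
Qed.

Lemma lattice_rchar V L (x : alg_dvr O A) : full_lattice V L ->
  rchar (mact V (toK x : alg_frac A)) = map_poly (valring_map O) (rchar (mact L x)).
Proof.
move=> [U [W [[_ _ UL] WU UW]]]; rewrite rchar_map.
rewrite -[mact V _]mulmx1 -UW mulmxA UL rchar_mulC mulmxA WU mul1mx //.
Qed.

Lemma lattice_sandmx V V' L L' (x y : alg_dvr O A) :
    full_lattice V L -> full_lattice V' L' ->
  rchar (sandmx (mact V (toK x : alg_frac A)) (mact V' (toK y : alg_frac A))) =
  map_poly (valring_map O) (rchar (sandmx (mact L x) (mact L' y))).
Proof.
move=> [U [W [[_ _ UL] WU UW]]] [U' [W' [[_ _ UL'] WU' UW']]].
rewrite rchar_map map_sandmx.
have -> : mact V (toK x : alg_frac A) = U *m (map_mx (valring_map O) (mact L x) *m W).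
  by rewrite mulmxA -UL -mulmxA UW mulmx1.
have -> : mact V' (toK y : alg_frac A) = U' *m map_mx (valring_map O) (mact L' y) *m W'.
  by rewrite -UL' -mulmxA UW' mulmx1.
rewrite -(sandmxM U _ W') rchar_mulC sandmxM -mulmxA WU mulmx1 mulmxA WU' mul1mx //.
Qed.

Lemma mact_lattice_red (L : module (alg_dvr O A)) (x : alg_dvr O A) :
  mact (lattice_red L) (tok x : alg_residue O A) = map_mx (residue_map O) (mact L x).
Proof. exact: mact_mod_tower. Qed.

Lemma residue_map_surj z : exists x, residue_map O x = z.
Proof. by exists (repr z); rewrite -[RHS]reprK. Qed.

Lemma tok_surj (z : alg_residue O A) : exists x : alg_dvr O A, tok x = z.
Proof.
have /choice[x xE] : forall i, exists x, residue_map O x = (z : 'rV_(arank A)) 0 i.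
  by move=> i; apply: residue_map_surj.
exists (\row_i x i); apply/rowP => i; rewrite !mxE; exact: xE.
Qed.

End Lattices.

Section CornerSandwich.
Variables (F : fieldType) (B : freeAlg F).

Lemma corner_sandmx e f (P Q V W : module B) : corner e P -> corner f Q ->
  rchar (sandmx (mact V e) (mact W f)) = (1 + 'X) ^+ (hom_dim P V * hom_dim Q W).
Proof.
move=> cP cQ; rewrite (corner_hom_dim _ cP) (corner_hom_dim _ cQ).
have idem (U : module B) g (E : module B) : corner g E -> mact U g *m mact U g = mact U g.
  by move=> /corner_idem gg; rewrite -mactM gg.
have eV := idem V e P cP; have fW := idem W f Q cQ.
rewrite -{1}(mulmx_base (mact V e)) -{1}(mulmx_base (mact W f)).
by rewrite rchar_sandmx_idem ?idem_base.
Qed.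

Lemma corner_rchar1 e (P W : module B) : corner e P ->
  rchar (mact W e) = (1 + 'X) ^+ (hom_dim P W).
Proof. by move=> cP; have := corner_rchar W 1 cP; rewrite !scale1r. Qed.

Lemma idem_poly1_inj : injective (fun d => (1 + 'X : {poly F}) ^+ d).
Proof. by have := @idem_poly_inj F 1 (oner_neq0 F); rewrite scale1r. Qed.

(* In the Grothendieck group of bimodules, B is the sum of the T (x) S^*; apply
   this to P = B (x)_B P. *)
Lemma cartan_filtration (l : seq (module B * module B)) :
    (forall a b : B, rchar (regmx a *m rmulmx b) =
       \prod_(TS <- l) rchar (sandmx (mact TS.1 a) (mact TS.2 b))) ->
  forall y, cartan B y = \sum_(TS <- l) G0cl TS.1 *~ intertwining y (G0cl TS.2).
Proof.
move=> lE y; elim/K0_ind: y => [|x y hx hy|P [_ [_ [e [_ cP]]]]].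
- rewrite raddf0 big1 // => TS _.
  by rewrite -[intertwining _ _]/(intertwining_l _ _) raddf0 mulr0z.
- rewrite raddfB /= hx hy -sumrB; apply: eq_bigr => TS _.
  by rewrite intertwining_l_zmod mulrzBr.
rewrite [LHS]gmorphE; apply: G0_nondegenerate => f Q cQ.
rewrite [LHS]intertwiningE raddf_sum.
under eq_bigr => TS _.
  rewrite raddfMz /= !intertwiningE; over.
rewrite -[hom_dim Q P](_ : (\sum_(TS <- l) hom_dim Q TS.1 * hom_dim P TS.2)%N = _).
  by rewrite (big_morph Posz PoszD (erefl _)); apply: eq_bigr => TS _; rewrite PoszM mulrzz.
(* Both numbers are exponents of 1 + X in [rchar] of x |-> f x e on B. *)
apply: idem_poly1_inj; rewrite -(corner_rchar1 _ cQ) (rchar_mact_corner _ cP) lE.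
by rewrite expr_sum; apply: eq_bigr => TS _; rewrite (corner_sandmx _ _ cQ cP).
Qed.

End CornerSandwich.

Lemma rchar_map_corners (F F' : fieldType) (g : {rmorphism F -> F'})
    (B : freeAlg F) (e f : B) (P Q : module B) : corner e P -> corner f Q ->
  rchar (map_mx g (regmx f) *m map_mx g (rmulmx e)) = (1 + 'X) ^+ (hom_dim Q P).
Proof.
move=> cP cQ; rewrite -map_mxM -rchar_map -(rchar_mact_corner _ cP).
by rewrite (corner_rchar1 _ cQ) rmorphXn rmorphD rmorph1 /= map_polyX.
Qed.

Section RcharDescent.
Variables (S S' : comNzRingType) (g : {rmorphism S -> S'}).
Variables (I : Type) (l : seq I) (h : I -> {poly S}) (n : nat) (M N : 'M[S]_n).

Lemma rchar_prod_descent : injective g ->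
    rchar (map_mx g M *m map_mx g N) = \prod_(i <- l) map_poly g (h i) ->
  rchar (M *m N) = \prod_(i <- l) h i.
Proof.
move=> /map_poly_injective ginj E; apply: ginj.
by rewrite rchar_map map_mxM E rmorph_prod.
Qed.

Lemma rchar_prod_map : rchar (M *m N) = \prod_(i <- l) h i ->
  rchar (map_mx g M *m map_mx g N) = \prod_(i <- l) map_poly g (h i).
Proof. by move=> E; rewrite -map_mxM -rchar_map E rmorph_prod. Qed.

End RcharDescent.

Section Decomposition.
Variables (R : idomainType) (p : prime_idealr R) (A : freeAlg R).
Variable O : perfect_gate p A.

Local Notation toK := (@bcmap _ _ _ (dvr_map O) (@tofrac R) (valring_map O) A).
Local Notation tok := (@bcmap _ _ _ (dvr_map O) (dvr_residue O) (residue_map O) A).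
Local Notation fib :=
  (@bcmap _ _ _ (kappa_map p) (dvr_residue O) (kappa_residue O) A).

Lemma corner_fib f (P : module (alg_fiber p A)) : corner f P ->
  exists P' : projmod (alg_residue O A), corner (fib f : alg_residue O A) P'.
Proof.
move=> /corner_idem ff; have [|P' cP'] := @corner_exists _ (alg_residue O A) (fib f).
  by rewrite -(bcmapM (kappa_residueE O)) ff.
by exists (ProjMod (corner_projective cP')).
Qed.

Lemma pairing_ext f (P : projmod (alg_fiber p A)) (P' : projmod (alg_residue O A)) x :
    corner f P -> corner (fib f : alg_residue O A) P' ->
  intertwining (K0cl P) x = intertwining (K0cl P') (fiber_ext O A x).
Proof.
move=> cP cP'; elim/groth_ind: x => [|x y hx hy|V]; first by rewrite !raddf0.
  by rewrite intertwining_r_zmod raddfB intertwining_r_zmod hx hy.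
rewrite [fiber_ext _ _ _]G0_extE !intertwiningE.
rewrite (corner_hom_dim _ cP) (corner_hom_dim _ cP') mact_mod_tower.
by rewrite mxrank_map.
Qed.

Lemma dec_pairing d f (P : projmod (alg_fiber p A)) (P' : projmod (alg_residue O A))
    (V : module (alg_frac A)) L :
    is_decomposition_map O d -> full_lattice V L ->
    corner f P -> corner (fib f : alg_residue O A) P' ->
  intertwining (K0cl P) (d (G0cl V)) = (hom_dim P' (lattice_red L))%:Z.
Proof.
move=> hd [U [W [latU _ _]]] cP cP'; rewrite (pairing_ext _ cP cP') (hd _ _ _ latU).
exact: intertwiningE.
Qed.

(* Brauer reciprocity without lifting of idempotents: the operators x |-> f x e
   on A^K and on A(p) both come from the lattice A^O, and the first one can be
   computed on the factors T (x) S^* of A^K. *)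
Lemma fiber_filtration d (l : seq (module (alg_frac A) * module (alg_frac A))) :
    is_decomposition_map O d ->
    (forall a b : alg_frac A, rchar (regmx a *m rmulmx b) =
       \prod_(TS <- l) rchar (sandmx (mact TS.1 a) (mact TS.2 b))) ->
  forall e f (P Q : projmod (alg_fiber p A)), corner e P -> corner f Q ->
  intertwining (K0cl Q) (G0cl P) = \sum_(TS <- l)
    intertwining (K0cl Q) (d (G0cl TS.1)) * intertwining (K0cl P) (d (G0cl TS.2)).
Proof.
move=> hd lE e f P Q cP cQ.
have /choice[lat latE] := @full_lattice_exists R p A O.
have [P' cP'] := corner_fib cP; have [Q' cQ'] := corner_fib cQ.
under eq_bigr => TS _.
  rewrite (dec_pairing hd (latE TS.1) cQ cQ') (dec_pairing hd (latE TS.2) cP cP').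
  over.
rewrite intertwiningE.
rewrite -[hom_dim Q P](_ : (\sum_(TS <- l) hom_dim Q' (lattice_red (lat TS.1)) *
    hom_dim P' (lattice_red (lat TS.2)))%N = _).
  by rewrite (big_morph Posz PoszD (erefl _)); apply: eq_bigr => TS _; rewrite PoszM.
have [eO eOE] := @tok_surj R p A O (fib e); have [fO fOE] := @tok_surj R p A O (fib f).
have rcharO : rchar (regmx fO *m rmulmx eO) =
    \prod_(TS <- l) rchar (sandmx (mact (lat TS.1) fO) (mact (lat TS.2) eO)).
  apply: (@rchar_prod_descent _ _ (valring_map O)); first exact: valring_map_inj.
  have E1 := regmx_bcmap (@dvr_mapE _ _ O) fO.
  have E2 := rmulmx_bcmap (@dvr_mapE _ _ O) eO.
  apply: (etrans (congr2 (fun X Y => rchar (X *m Y)) E1 E2)).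
  apply: (etrans (lE _ _)); apply: eq_bigr => TS _.
  exact: lattice_sandmx.
have redE := rchar_prod_map (residue_map O) rcharO.
(* Multiplication by fO modulo m is multiplication by f on A(p), extended to k(m); likewise for eO
   and e. *)
have E1 : map_mx (residue_map O) (regmx fO) = map_mx (kappa_residue O) (regmx f).
  have := regmx_bcmap (fun r => erefl (dvr_residue O r)) fO; rewrite fOE => ->.
  exact: esym (regmx_bcmap (kappa_residueE O) f).
have E2 : map_mx (residue_map O) (rmulmx eO) = map_mx (kappa_residue O) (rmulmx e).
  have := rmulmx_bcmap (fun r => erefl (dvr_residue O r)) eO; rewrite eOE => ->.
  exact: esym (rmulmx_bcmap (kappa_residueE O) e).
have termE TS : map_poly (residue_map O)
      (rchar (sandmx (mact (lat TS.1) fO) (mact (lat TS.2) eO))) =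
    (1 + 'X) ^+ (hom_dim Q' (lattice_red (lat TS.1)) * hom_dim P' (lattice_red (lat TS.2))).
  rewrite -(corner_sandmx (lattice_red (lat TS.1)) (lattice_red (lat TS.2)) cQ' cP').
  rewrite -fOE -eOE !mact_lattice_red rchar_map map_sandmx //.
apply: (@idem_poly1_inj (residue_field O)).
apply: (etrans _ (rchar_map_corners (kappa_residue O) cP cQ)).
apply: (etrans _ (congr2 (fun X Y => rchar (X *m Y)) E1 E2)).
apply: (etrans _ (esym redE)); rewrite expr_sum; apply: eq_bigr => TS _.
by rewrite termE.
Qed.

End Decomposition.

(** * Normal domains *)

Lemma zmod_morphism_additive (U V : zmodType) (f : U -> V) : zmod_morphism f ->
  exists g : {additive U -> V}, g =1 f.
Proof.
move=> hf.
pose g : {additive U -> V} := HB.pack f (GRing.isZmodMorphism.Build U V f hf).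
by exists g.
Qed.

Section NormalDomain.
Variables (R : idomainType) (A : freeAlg R).
Local Notation K := {fraction R}.
Local Notation inK a := (bcin (@tofrac R) a : alg_frac A).

Lemma integralOver_inj (L : fieldType) (iota : {rmorphism K -> L}) x :
  integralOver (iota \o @tofrac R) (iota x) -> integralOver (@tofrac R) x.
Proof.
move=> [q mq qx]; exists q => //; move: qx.
by rewrite map_poly_comp fmorph_root.
Qed.

Lemma regmx_bcin (a : A) : regmx (inK a) = map_mx (@tofrac R) (regmx a).
Proof.
apply/matrixP => i j; rewrite !mxE bc_abasis.
by rewrite [inK a * _]bcmul_in mxE.
Qed.

(** A row eigenvector on V pulls back along the orbit maps from A^K, non-trivially for at least one,
    to an eigenvector of left multiplication by a. That matrix has entries in R. *)
Lemma eigenvalue_integral (L : fieldType) (iota : {rmorphism K -> L})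
    (V : module (alg_frac A)) (a : A) z :
    eigenvalue (map_mx iota (mact V (inK a))) z ->
  integralOver (iota \o @tofrac R) z.
Proof.
move=> /eigenvalueP[v vE v0].
have [j vj] : exists j, v *m map_mx iota (orbmx (delta_mx j 0 : 'cV_(mdim V))) != 0.
  apply: contrapT => nj; case/eqP: v0; apply: trmx_inj; apply/colP => j.
  have vj : v *m map_mx iota (orbmx (delta_mx j 0 : 'cV_(mdim V))) = 0.
    by apply/eqP; apply: contrapT => h; apply: nj; exists j; apply/negP.
  move/(congr1 (mulmxr (map_mx iota (acol (1 : alg_frac A))))): vj.
  rewrite /= -mulmxA -map_mxM orbmxE mact1 mul1mx mul0mx map_delta_mx -colE.
  by move=> /rowP/(_ 0); rewrite !mxE.
set w := v *m _ in vj.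
have wE : w *m map_mx (iota \o @tofrac R) (regmx a) = z *: w.
  rewrite map_mx_comp -regmx_bcin /w -mulmxA -map_mxM.
  by rewrite -(orbmx_hom _ (inK a)) map_mxM mulmxA vE scalemxAl.
have : eigenvalue (map_mx (iota \o @tofrac R) (regmx a)) z by apply/eigenvalueP; exists w.
rewrite eigenvalue_root_char -map_char_poly => zroot.
by exists (char_poly (regmx a)); first exact: char_poly_monic.
Qed.

(* The roots of rchar M are the -1/z for z a non-zero eigenvalue of M. *)
Lemma rchar_integral (V : module (alg_frac A)) (a : A) i :
  integralOver (@tofrac R) (rchar (mact V (inK a)))`_i.
Proof.
set M := mact V _; have [L [iota [rs]]] := splitting_field (rchar M).
set c := lead_coef _; rewrite rchar_map => DE.
have D0 : (rchar (map_mx iota M)).[0] = 1 by rewrite horner_rchar scale0r addr0 det1.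
have c0 : c != 0.
  by apply: contra_eq_neq D0 => c0; rewrite DE c0 scale0r horner0 eq_sym oner_neq0.
have rs_root z : z \in rs -> z != 0 /\ integralOver (iota \o @tofrac R) (- z^-1).
  move=> zrs; have Dz : (rchar (map_mx iota M)).[z] = 0.
    by apply/eqP; rewrite -[_ == _]/(root _ _) DE rootZ // root_prod_XsubC.
  have z0 : z != 0 by apply: contra_eq_neq Dz => ->; rewrite D0 oner_neq0.
  split=> //; apply: (@eigenvalue_integral _ _ V a); apply/eigenvalueP.
  move: Dz; rewrite horner_rchar => /eqP/det0P[v v0].
  rewrite mulmxDr mulmx1 -scalemxAr => /eqP; rewrite addrC addr_eq0 => /eqP vE.
  exists v => //; apply: (scalerI z0); rewrite vE scalerA mulrN mulfV //.
  by rewrite scaleN1r.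
(* The constant term 1 fixes the normalisation: c times the product of the -z equals 1. *)
have DE' : rchar (map_mx iota M) = \prod_(z <- rs) (1 + (- z^-1) *: 'X).
  have E : rchar (map_mx iota M) =
      (c * \prod_(z <- rs) - z) *: \prod_(z <- rs) (1 + (- z^-1) *: 'X).
    rewrite DE -scalerA; congr (_ *: _).
    rewrite -scaler_prod big_seq [RHS]big_seq; apply: eq_bigr => z zrs.
    have [z0 _] := rs_root z zrs; rewrite scalerDr scalerA mulrNN mulfV // scale1r.
    by rewrite addrC scaleNr alg_polyC.
  have P0 : (\prod_(z <- rs) (1 + (- z^-1) *: 'X)).[0] = 1.
    by rewrite horner_prod big1 // => z _; rewrite hornerD hornerZ hornerX hornerC mulr0 addr0.
  by rewrite E; move: D0; rewrite E hornerZ P0 mulr1 => ->; rewrite scale1r.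
apply: (@integralOver_inj _ iota).
have -> : iota (rchar M)`_i = (rchar (map_mx iota M))`_i by rewrite -rchar_map coef_map.
rewrite DE' big_seq; elim/big_rec: _ i => [i|z q zrs intq i].
  by rewrite coef1; apply: integral_nat.
rewrite mulrDl mul1r -scalerAl coefD coefZ coefXM.
apply: integral_add => //; apply: integral_mul; first by case: (rs_root z zrs).
by case: (i == 0%N); [apply: integral0 | apply: intq].
Qed.

Lemma rchar_normal (V : module (alg_frac A)) (a : A) : normal_domain R ->
  exists q : {poly R}, rchar (mact V (inK a)) = map_poly (@tofrac R) q.
Proof.
move=> nR; have /choice[r rE] i := nR _ (rchar_integral V a i).
exists (\poly_(i < size (rchar (mact V (inK a)))) r i); apply/polyP => i.
rewrite coef_map coef_poly /=; case: ltnP => [_|szi]; first exact: rE.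
by rewrite rmorph0 nth_default.
Qed.

End NormalDomain.

Lemma map_poly_tower (R S S' : comNzRingType) (f : {rmorphism R -> S})
    (g : {rmorphism S -> S'}) (h : {rmorphism R -> S'}) :
  (forall r, g (f r) = h r) ->
  forall q, map_poly g (map_poly f q) = map_poly h q.
Proof. by move=> gf q; apply/polyP => i; rewrite !coef_map; apply: gf. Qed.

(** * Independence of the gate *)

Section Independence.
Variables (R : idomainType) (p : prime_idealr R) (A : freeAlg R).

(** The common denominator is taken in R, so that s f comes from A itself and every gate sees the
    same element. *)
Lemma clear_denominators n (f : 'I_n -> kappa p) : exists (s : R) (a : 'I_n -> R),
  s \notin p /\ forall i, kappa_map p s * f i = kappa_map p (a i).
Proof.
have kappa0 s : (kappa_map p s == 0) = (s \in p).
  by rewrite /= tofrac_eq0 prime_proj_eq0.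
have /choice[ab abE] i : exists ab : R * R,
    ab.2 \notin p /\ kappa_map p ab.2 * f i = kappa_map p ab.1.
  have [x [y [y0 fE _]]] := @frac_repr (prime_quot p) (kappa p) (@tofrac (prime_quot p)) (f i).
  have [a xE] := prime_proj_surj x; have [b yE] := prime_proj_surj y.
  exists (a, b); rewrite -kappa0 /= -yE tofrac_eq0; split=> //.
  by rewrite -xE fE mulrC divfK ?tofrac_eq0.
exists (\prod_i (ab i).2), (fun i => (ab i).1 * \prod_(j | j != i) (ab j).2); split.
  apply/negP; rewrite -kappa0 rmorph_prod => /prodf_eq0[i _].
  by rewrite kappa0; have [/negPf ->] := abE i.
move=> i; have [_ fE] := abE i.
by rewrite (bigD1 i) // [kappa_map p _]rmorphM mulrAC fE -rmorphM.
Qed.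

Variable O : perfect_gate p A.
Local Notation fib :=
  (@bcmap _ _ _ (kappa_map p) (dvr_residue O) (kappa_residue O) A).
Local Notation inK a := (bcin (@tofrac R) a : alg_frac A).

(* <[P], d [V]> is read off from the characteristic polynomial of s f on V,
   where s clears the denominators of the idempotent f. *)
Lemma dec_pairing_rchar d f (P : projmod (alg_fiber p A)) (V : module (alg_frac A))
    (s : R) (a : A) (q : {poly R}) :
    is_decomposition_map O d -> corner f P ->
    bcscale (kappa_map p s) (f : bchange (kappa_map p) A) = bcin (kappa_map p) a ->
    rchar (mact V (inK a)) = map_poly (@tofrac R) q ->
  exists2 n : nat, intertwining (K0cl P) (d (G0cl V)) = n%:Z &
    map_poly (kappa_map p) q = (1 + kappa_map p s *: 'X) ^+ n.
Proof.
move=> hd cP sf qE; have [P' cP'] := corner_fib O cP.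
have [L latL] := full_lattice_exists O V.
exists (hom_dim P' (lattice_red L)); first exact: dec_pairing hd latL cP cP'.
apply: (map_poly_injective (fmorph_inj (kappa_residue O))).
(* Since a lifts s f, it acts on the reduced lattice as s times an idempotent. *)
have aE : dvr_residue O s *: mact (lattice_red L) (fib f : alg_residue O A) =
    map_mx (residue_map O) (mact L (bcin (dvr_map O) a : alg_dvr O A)).
  rewrite -mact_lattice_red -[LHS]mactZ; congr (mact _ _).
  rewrite [LHS]bcscalE [RHS]bcmap_bcin // -(bcmap_bcin (kappa_residueE O)) -sf.
  by rewrite /bcmap /bcscale map_mxZ kappa_residueE.
have LE : rchar (mact L (bcin (dvr_map O) a : alg_dvr O A)) = map_poly (dvr_map O) q.
  apply: (map_poly_injective (@valring_map_inj _ _ _ O)); rewrite -(lattice_rchar _ latL).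
  rewrite (bcmap_bcin (@dvr_mapE _ _ O)) qE.
  exact: esym (map_poly_tower (@dvr_mapE _ _ O) q).
have E := corner_rchar (lattice_red L) (dvr_residue O s) cP'.
rewrite aE -rchar_map LE in E.
(* The maps R -> k(p) -> k(m) and R -> O -> k(m) agree. *)
apply: (etrans (map_poly_tower (kappa_residueE O) q)).
apply: (etrans (esym (map_poly_tower (fun r => erefl (dvr_residue O r)) q))).
apply: (etrans E).
by rewrite rmorphXn rmorphD rmorph1 /= linearZ /= map_polyX kappa_residueE.
Qed.

End Independence.

Theorem theorem6p2 (R : idomainType) (A : freeAlg R)
    (hsplit : split_alg (alg_frac A))
    (hgates : forall q : prime_idealr R, nonzero_ideal q ->
       inhabited (perfect_gate q A))
    (p : prime_idealr R) (hp : nonzero_ideal p) :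
  (forall (O : perfect_gate p A)
          (d : {additive G0 (alg_frac A) -> G0 (alg_fiber p A)}),
     is_decomposition_map O d ->
     exists e : {additive K0 (alg_fiber p A) -> K0 (alg_frac A)},
       [/\ is_adjoint d e,
           forall e' : {additive K0 (alg_fiber p A) -> K0 (alg_frac A)},
             is_adjoint d e' -> e' =1 e &
           cartan (alg_fiber p A) =1 d \o cartan (alg_frac A) \o e])
  /\
  (normal_domain R ->
     forall (O O' : perfect_gate p A)
            (d d' : {additive G0 (alg_frac A) -> G0 (alg_fiber p A)})
            (e e' : {additive K0 (alg_fiber p A) -> K0 (alg_frac A)}),
       is_decomposition_map O d -> is_decomposition_map O' d' ->
       is_adjoint d e -> is_adjoint d' e' -> e =1 e').
Proof.
split=> [O d hd|nR O O' d d' e e' hd hd' he he'].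
  (* Each x defines an additive function on G_0(A^K) through d; e0 picks the class representing it,
     and non-degeneracy makes e0 additive. *)
  have /choice[e0 e0E] (x : K0 (alg_fiber p A)) : exists y : K0 (alg_frac A),
      forall v, intertwining y v = intertwining x (d v).
    exact: (K0_represents hsplit (intertwining x \o d)).
  have [|e eE] := @zmod_morphism_additive _ _ e0.
    move=> x y; apply: K0_nondegenerate => V.
    by rewrite e0E !intertwining_l_zmod !e0E.
  exists e; split=> [P V|e' he'|]; first by rewrite eE e0E.
    apply: additive_K0_eq => f P _; apply: K0_nondegenerate => V.
    by rewrite he' eE e0E.
  (* The same list l computes the Cartan map of A^K and, through d, that of A(p). *)
  have [l lE] := bimod_filtration hsplit (regbimod (alg_frac A)).
  apply: additive_K0_eq => f P cP; apply: G0_nondegenerate => g Q cQ.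
  rewrite [cartan _ _]gmorphE (fiber_filtration hd lE cP cQ) /=.
  rewrite (cartan_filtration lE) !raddf_sum; apply: eq_bigr => TS _.
  by rewrite raddfMz raddfMz eE e0E mulrzz.
apply: additive_K0_eq => f P cP; apply: K0_nondegenerate => V.
rewrite he he'; have [s [a [sp sf]]] := clear_denominators (fun i => (f : 'rV_(arank A)) 0 i).
have [b bE] : exists b : A, forall i, acoord b 0 i = a i.
  have [c cE] := acol_surj (\col_i a i); exists c => i.
  by rewrite -acolE cE mxE.
have sfE : bcscale (kappa_map p s) f = bcin (kappa_map p) b.
  by apply/rowP => i; rewrite !mxE sf bE.
(* As q lies over R, its image over k(p) is the same for both gates, and it determines both
   exponents. *)
have [q qE] := rchar_normal V b nR.
have [n -> nE] := dec_pairing_rchar hd cP sfE qE.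
have [n' -> n'E] := dec_pairing_rchar hd' cP sfE qE.
congr Posz; apply: (@idem_poly_inj _ (kappa_map p s)); last by rewrite -nE -n'E.
by rewrite /= tofrac_eq0 prime_proj_eq0.
Qed.
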